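(* Let $E$ be a finite graph and $K$ any field. Then the following are equivalent: (1) $L_K(E)$ has cancellation of projectives; (2) $L_K(E)$ is Hermite; (3) $L_K(E)$ is stably finite; (4) $L_K(E)$ is directly finite; (5) $E$ is a no-exit graph.
   Context: A (directed) graph $E=(E^0,E^1,s,r)$ consists of disjoint sets $E^0$ (vertices) and $E^1$ (edges) and maps $s,r:E^1\to E^0$ (source and range); it is finite if $E^0$ and $E^1$ are finite. Graphs are assumed to have at least one vertex. A vertex $v$ is regular if $0<|s^{-1}(v)|<\infty$. For a field $K$, the Leavitt path algebra $L_K(E)$ is the $K$-algebra generated by the set $\{v,e,e^*\mid v\in E^0,e\in E^1\}$ subject to, for all $v,w\in E^0$, $e,f\in E^1$: (1) $vw=\delta_{v,w}w$; (2) $s(e)e=e=er(e)$ and $r(e)e^*=e^*=e^*s(e)$; (3) $e^*f=\delta_{e,f}r(e)$; (4) $v=\sum_{e\in s^{-1}(v)}ee^*$ for every regular vertex $v$. For finite $E$ it is unital with identity $\sum_{v\in E^0}v$. A path is a sequence of edges $p=e_1\cdots e_n$ ($n\ge1$) with $r(e_i)=s(e_{i+1})$ for $1\le i<n$; it is closed if $r(e_n)=s(e_1)$. A closed path $e_1\cdots e_n$ with $s(e_1),\dots,s(e_n)$ distinct determines a cycle (the subgraph with vertices $s(e_1),\dots,s(e_n)$ and edges $e_1,\dots,e_n$). An edge $f$ is an exit for $p=e_1\cdots e_n$ if $s(f)=s(e_i)$ but $f\neq e_i$ for some $1\le i\le n$. $E$ is a no-exit graph if no cycle in $E$ has an exit.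 Let $R$ be a (nonzero, associative, unital) ring. $R$ is directly finite if for $a,b\in R$, $ab=1$ implies $ba=1$. $R$ is stably finite if for every positive integer $n$ and right $R$-module $Q$, $R^n\cong R^n\oplus Q$ (as right $R$-modules) implies $Q=0$. $R$ is Hermite if for all positive integers $m,n$ and any right $R$-module $Q$, $R^n\cong R^m\oplus Q$ implies $n\ge m$ and $Q\cong R^{n-m}$. $R$ has cancellation of projectives if for any finitely generated projective right $R$-modules $P,P'$, $P\oplus R\cong P'\oplus R$ implies $P\cong P'$. *)

(* Defs.v *)
From HB Require Import structures.
From mathcomp Require Import all_boot all_algebra.
From mathcomp Require Import boolp.

Set Implicit Arguments.
Unset Strict Implicit.
Unset Printing Implicit Defensive.

Import GRing.Theory.
Local Open Scope ring_scope.
Local Open Scope quotient_scope.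

Record finGraph := FinGraph {
  vertex : finType;
  edge : finType;
  src : edge -> vertex;
  rng : edge -> vertex;
  vertex_gt0 : (0 < #|vertex|)%N
}.

Section Paths.
Variable E : finGraph.
Implicit Types (p : seq (edge E)) (f : edge E) (v : vertex E).

(* Every vertex of a finite graph emits finitely many edges. *)
Definition regular v : bool := [exists f, src f == v].

Definition composable : rel (edge E) := [rel e f | rng e == src f].

(* [cycle] is the predicate of [path.v]: [e_1; ...; e_n] is [composable]-sorted
   and, in addition, [composable e_n e_1] holds. *)
Definition closed_path p : bool := (p != [::]) && cycle composable p.

Definition cycle_path p : bool := closed_path p && uniq [seq src e | e <- p].

Definition exit_for f p : bool := [exists e in p, (src f == src e) && (f != e)].

Definition no_exit : Prop :=
  forall p, cycle_path p -> ~ exists f, exit_for f p.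

End Paths.

(* L_K(E) is presented as a not necessarily unital associative K-algebra: it is
   the quotient of the algebraic expressions in the generators v, e, e^* by the
   least congruence containing the axioms of (non-unital) K-algebras and the
   four families of Leavitt relations.  The identity is not part of the
   presentation: it is the sum of the vertices. *)
Section LeavittPathAlgebra.
Variables (K : fieldType) (E : finGraph).

Inductive lexpr : Type :=
  | Vert of vertex E
  | Edge of edge E
  | Ghost of edge E
  | Zero
  | Add of lexpr & lexpr
  | Scale of K & lexpr
  | Mul of lexpr & lexpr.

Inductive leq_rel : lexpr -> lexpr -> Prop :=
  | LRefl x : leq_rel x x
  | LSym x y : leq_rel x y -> leq_rel y x
  | LTrans x y z : leq_rel x y -> leq_rel y z -> leq_rel x z
  | LAddCongr x x' y y' :
      leq_rel x x' -> leq_rel y y' -> leq_rel (Add x y) (Add x' y')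
  | LScaleCongr a x x' : leq_rel x x' -> leq_rel (Scale a x) (Scale a x')
  | LMulCongr x x' y y' :
      leq_rel x x' -> leq_rel y y' -> leq_rel (Mul x y) (Mul x' y')
  | LAddA x y z : leq_rel (Add x (Add y z)) (Add (Add x y) z)
  | LAddC x y : leq_rel (Add x y) (Add y x)
  | LAdd0 x : leq_rel (Add Zero x) x
  | LAddN x : leq_rel (Add (Scale (-1) x) x) Zero
  | LScaleA a b x : leq_rel (Scale a (Scale b x)) (Scale (a * b) x)
  | LScale1 x : leq_rel (Scale 1 x) x
  | LScaleDr a x y : leq_rel (Scale a (Add x y)) (Add (Scale a x) (Scale a y))
  | LScaleDl a b x : leq_rel (Scale (a + b) x) (Add (Scale a x) (Scale b x))
  | LMulA x y z : leq_rel (Mul x (Mul y z)) (Mul (Mul x y) z)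
  | LMulDl x y z : leq_rel (Mul (Add x y) z) (Add (Mul x z) (Mul y z))
  | LMulDr x y z : leq_rel (Mul x (Add y z)) (Add (Mul x y) (Mul x z))
  | LScaleAl a x y : leq_rel (Scale a (Mul x y)) (Mul (Scale a x) y)
  | LScaleAr a x y : leq_rel (Scale a (Mul x y)) (Mul x (Scale a y))
  | LVert v w : leq_rel (Mul (Vert v) (Vert w)) (if v == w then Vert w else Zero)
  | LSrcEdge e : leq_rel (Mul (Vert (src e)) (Edge e)) (Edge e)
  | LEdgeRng e : leq_rel (Mul (Edge e) (Vert (rng e))) (Edge e)
  | LRngGhost e : leq_rel (Mul (Vert (rng e)) (Ghost e)) (Ghost e)
  | LGhostSrc e : leq_rel (Mul (Ghost e) (Vert (src e))) (Ghost e)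
  | LGhostEdge e f :
      leq_rel (Mul (Ghost e) (Edge f)) (if e == f then Vert (rng e) else Zero)
  | LRegular v : regular v ->
      leq_rel (Vert v) (\big[Add/Zero]_(e | src e == v) Mul (Edge e) (Ghost e)).

HB.instance Definition _ := gen_eqMixin lexpr.
HB.instance Definition _ := gen_choiceMixin lexpr.

Definition lequiv : rel lexpr := fun x y => `[< leq_rel x y >].

Fact lequiv_refl : reflexive lequiv.
Proof. by move=> x; apply/asboolP; exact: LRefl. Qed.

Fact lequiv_sym : symmetric lequiv.
Proof. by move=> x y; apply/asboolP/asboolP => /LSym. Qed.

Fact lequiv_trans : transitive lequiv.
Proof.
by move=> y x z /asboolP xy /asboolP yz; apply/asboolP; exact: LTrans xy yz.
Qed.

Canonical lequiv_equivRel := EquivRel lequiv lequiv_refl lequiv_sym lequiv_trans.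

Definition leavitt : Type := {eq_quot lequiv}.

HB.instance Definition _ := Choice.on leavitt.
HB.instance Definition _ := EqQuotient.on leavitt.

Lemma leavitt_piP x y : \pi_leavitt x = \pi_leavitt y <-> leq_rel x y.
Proof. by split=> [/eqmodP/asboolP | xy]; last by apply/eqmodP/asboolP. Qed.

Lemma leavitt_repr_pi x : leq_rel (repr (\pi_leavitt x)) x.
Proof. by apply/leavitt_piP; rewrite reprK. Qed.

Definition lzero : leavitt := \pi_leavitt Zero.
Definition ladd : leavitt -> leavitt -> leavitt := lift_op2 leavitt Add.
Definition lscale (a : K) : leavitt -> leavitt := lift_op1 leavitt (Scale a).
Definition lopp (x : leavitt) : leavitt := lscale (-1) x.
Definition lmul : leavitt -> leavitt -> leavitt := lift_op2 leavitt Mul.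
Definition lone : leavitt := \big[ladd/lzero]_(v : vertex E) \pi_leavitt (Vert v).

Lemma ladd_pi x y : ladd (\pi_leavitt x) (\pi_leavitt y) = \pi_leavitt (Add x y).
Proof. by unlock ladd; apply/leavitt_piP; apply: LAddCongr; exact: leavitt_repr_pi. Qed.

Lemma lscale_pi a x : lscale a (\pi_leavitt x) = \pi_leavitt (Scale a x).
Proof. by unlock lscale; apply/leavitt_piP; apply: LScaleCongr; exact: leavitt_repr_pi. Qed.

Lemma lmul_pi x y : lmul (\pi_leavitt x) (\pi_leavitt y) = \pi_leavitt (Mul x y).
Proof. by unlock lmul; apply/leavitt_piP; apply: LMulCongr; exact: leavitt_repr_pi. Qed.

Fact laddA : associative ladd.
Proof.
elim/quotW=> x; elim/quotW=> y; elim/quotW=> z.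
by rewrite !ladd_pi; apply/leavitt_piP; exact: LAddA.
Qed.

Fact laddC : commutative ladd.
Proof.
elim/quotW=> x; elim/quotW=> y.
by rewrite !ladd_pi; apply/leavitt_piP; exact: LAddC.
Qed.

Fact ladd0 : left_id lzero ladd.
Proof. by elim/quotW=> x; rewrite ladd_pi; apply/leavitt_piP; exact: LAdd0. Qed.

Fact laddN : left_inverse lzero lopp ladd.
Proof.
elim/quotW=> x.
by rewrite /lopp lscale_pi ladd_pi; apply/leavitt_piP; exact: LAddN.
Qed.

HB.instance Definition _ := GRing.isZmodule.Build leavitt laddA laddC ladd0 laddN.

Fact laddE x y : \pi_leavitt x + \pi_leavitt y = \pi_leavitt (Add x y).
Proof. exact: ladd_pi. Qed.

Fact lscaleA a b x : lscale a (lscale b x) = lscale (a * b) x.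
Proof.
by elim/quotW: x => x; rewrite !lscale_pi; apply/leavitt_piP; exact: LScaleA.
Qed.

Fact lscale1 : left_id 1 lscale.
Proof.
by elim/quotW=> x; rewrite lscale_pi; apply/leavitt_piP; exact: LScale1.
Qed.

Fact lscaleDr : right_distributive lscale +%R.
Proof.
move=> a; elim/quotW=> x; elim/quotW=> y.
by rewrite !(laddE, lscale_pi); apply/leavitt_piP; exact: LScaleDr.
Qed.

Fact lscaleDl x : {morph lscale^~ x : a b / a + b}.
Proof.
move=> a b; elim/quotW: x => x.
by rewrite !(laddE, lscale_pi); apply/leavitt_piP; exact: LScaleDl.
Qed.

HB.instance Definition _ :=
  GRing.Zmodule_isLmodule.Build K leavitt lscaleA lscale1 lscaleDr lscaleDl.

Fact lscaleE a x : a *: \pi_leavitt x = \pi_leavitt (Scale a x).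
Proof. exact: lscale_pi. Qed.

Fact lmulA : associative lmul.
Proof.
elim/quotW=> x; elim/quotW=> y; elim/quotW=> z.
by rewrite !lmul_pi; apply/leavitt_piP; exact: LMulA.
Qed.

Fact lmulDl : left_distributive lmul +%R.
Proof.
elim/quotW=> x; elim/quotW=> y; elim/quotW=> z.
by rewrite !(lmul_pi, laddE); apply/leavitt_piP; exact: LMulDl.
Qed.

Fact lmulDr : right_distributive lmul +%R.
Proof.
elim/quotW=> x; elim/quotW=> y; elim/quotW=> z.
by rewrite !(lmul_pi, laddE); apply/leavitt_piP; exact: LMulDr.
Qed.

Fact lscaleAl a (x y : leavitt) : a *: lmul x y = lmul (a *: x) y.
Proof.
elim/quotW: x => x; elim/quotW: y => y.
by rewrite !(lmul_pi, lscaleE); apply/leavitt_piP; exact: LScaleAl.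
Qed.

Fact lscaleAr a (x y : leavitt) : a *: lmul x y = lmul x (a *: y).
Proof.
elim/quotW: x => x; elim/quotW: y => y.
by rewrite !(lmul_pi, lscaleE); apply/leavitt_piP; exact: LScaleAr.
Qed.

Fact lmul0l x : lmul 0 x = 0.
Proof. by apply: (addrI (lmul 0 x)); rewrite -lmulDl !addr0. Qed.

Fact lmul0r x : lmul x 0 = 0.
Proof. by apply: (addrI (lmul x 0)); rewrite -lmulDr !addr0. Qed.

Fact loneE : lone = \sum_v \pi_leavitt (Vert v).
Proof. by []. Qed.

Fact lone_mul_vert w : lmul lone (\pi_leavitt (Vert w)) = \pi_leavitt (Vert w).
Proof.
rewrite loneE (big_morph (lmul^~ _) (fun x y => lmulDl x y _) (lmul0l _)).
rewrite (bigD1 w) //= big1 ?addr0 => [|v /negPf vw]; rewrite lmul_pi.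
  by apply/leavitt_piP; have := LVert w w; rewrite eqxx.
by apply/leavitt_piP; have := LVert v w; rewrite vw.
Qed.

Fact lvert_mul_one w : lmul (\pi_leavitt (Vert w)) lone = \pi_leavitt (Vert w).
Proof.
rewrite loneE (big_morph (lmul _) (lmulDr _) (lmul0r _)).
rewrite (bigD1 w) //= big1 ?addr0 => [|v]; rewrite lmul_pi.
  by apply/leavitt_piP; have := LVert w w; rewrite eqxx.
rewrite eq_sym => /negPf vw.
by apply/leavitt_piP; have := LVert w v; rewrite vw.
Qed.

Fact lmul1 : left_id lone lmul.
Proof.
have fixV w x : lmul (\pi_leavitt (Vert w)) x = x -> lmul lone x = x.
  by move=> <-; rewrite lmulA lone_mul_vert.
elim/quotW; elim=> [w|e|e||x IHx y IHy|a x IHx|x IHx y IHy].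
- exact: lone_mul_vert.
- apply: (fixV (src e)); rewrite lmul_pi.
  by apply/leavitt_piP; exact: LSrcEdge.
- apply: (fixV (rng e)); rewrite lmul_pi.
  by apply/leavitt_piP; exact: LRngGhost.
- exact: lmul0r.
- by rewrite -laddE lmulDr IHx IHy.
- by rewrite -lscaleE -lscaleAr IHx.
- by rewrite -lmul_pi lmulA IHx.
Qed.

Fact lmulr1 : right_id lone lmul.
Proof.
have fixV w x : lmul x (\pi_leavitt (Vert w)) = x -> lmul x lone = x.
  by move=> <-; rewrite -lmulA lvert_mul_one.
elim/quotW; elim=> [w|e|e||x IHx y IHy|a x IHx|x IHx y IHy].
- exact: lvert_mul_one.
- apply: (fixV (rng e)); rewrite lmul_pi.
  by apply/leavitt_piP; exact: LEdgeRng.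
- apply: (fixV (src e)); rewrite lmul_pi.
  by apply/leavitt_piP; exact: LGhostSrc.
- exact: lmul0l.
- by rewrite -laddE lmulDl IHx IHy.
- by rewrite -lscaleE -lscaleAl IHx.
- by rewrite -lmul_pi -lmulA IHy.
Qed.

HB.instance Definition _ :=
  GRing.Zmodule_isPzRing.Build leavitt lmulA lmul1 lmulr1 lmulDl lmulDr.

(* To see that L_K(E) is nonzero, let it act on the functions from
   nat * vertex E to K, where, for every regular vertex v, the slice over v is
   cut into one copy of nat for each edge leaving v, by euclidean division. *)
Local Definition outs (v : vertex E) : seq (edge E) := enum [pred e | src e == v].
Local Definition rk (e : edge E) : nat := index e (outs (src e)).
Local Definition deg (v : vertex E) : nat := size (outs v).

Fact rk_lt e : (rk e < deg (src e))%N.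
Proof. by rewrite index_mem mem_enum inE. Qed.

Fact rk_inj e f : src e = src f -> rk e = rk f -> e = f.
Proof.
rewrite /rk => -> eq_ef; rewrite -(nth_index e (s := outs (src f)) (x := f)).
  by rewrite -eq_ef nth_index // -index_mem eq_ef index_mem mem_enum inE.
by rewrite mem_enum inE.
Qed.

Local Definition fn := nat -> vertex E -> K.

Fact divn_cons e n : ((n * deg (src e) + rk e) %/ deg (src e))%N = n.
Proof.
by rewrite divnMDl ?(leq_ltn_trans _ (rk_lt e)) // divn_small ?addn0 ?rk_lt.
Qed.

Fact modn_cons e n : ((n * deg (src e) + rk e) %% deg (src e))%N = rk e.
Proof. by rewrite modnMDl modn_small ?rk_lt. Qed.

Fixpoint lact (x : lexpr) (phi : fn) (n : nat) (u : vertex E) {struct x} : K :=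
  match x with
  | Vert v => if u == v then phi n u else 0
  | Edge e => if (u == src e) && (n %% deg u == rk e)%N
              then phi (n %/ deg u)%N (rng e) else 0
  | Ghost e => if u == rng e then phi (n * deg (src e) + rk e)%N (src e) else 0
  | Zero => 0
  | Add y z => lact y phi n u + lact z phi n u
  | Scale a y => a * lact y phi n u
  | Mul y z => lact y (lact z phi) n u
  end.

Fact lact_ext x phi psi :
  (forall n u, phi n u = psi n u) -> forall n u, lact x phi n u = lact x psi n u.
Proof.
elim: x phi psi => [v|e|e||x IHx y IHy|a x IHx|x IHx y IHy] phi psi eq_pp n u //=;
  rewrite ?eq_pp //; first by rewrite (IHx phi psi) // (IHy phi psi).
- by rewrite (IHx phi psi).
- by apply: IHx => m w; apply: IHy.
Qed.

Fact lact_lin x a phi psi n u :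
  lact x (fun m w => a * phi m w + psi m w) n u
  = a * lact x phi n u + lact x psi n u.
Proof.
elim: x phi psi n u => [v|e|e||x IHx y IHy|b x IHx|x IHx y IHy] phi psi n u /=.
- by case: ifP; rewrite ?mulr0 ?addr0.
- by case: ifP; rewrite ?mulr0 ?addr0.
- by case: ifP; rewrite ?mulr0 ?addr0.
- by rewrite mulr0 addr0.
- by rewrite IHx IHy mulrDr addrACA.
- by rewrite IHx mulrDr mulrCA.
- by rewrite -IHx; apply: lact_ext => m w; rewrite IHy.
Qed.

Fact lactD x phi psi n u :
  lact x (fun m w => phi m w + psi m w) n u = lact x phi n u + lact x psi n u.
Proof.
rewrite -[X in X + _]mul1r -lact_lin; apply: lact_ext => m w.
by rewrite mul1r.
Qed.

Fact lact0 x n u : lact x (fun _ _ => 0) n u = 0.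
Proof.
apply: (addrI (lact x (fun _ _ => 0) n u)); rewrite -lactD [RHS]addr0.
by apply: lact_ext => m w; rewrite addr0.
Qed.

Fact lactZ x a phi n u :
  lact x (fun m w => a * phi m w) n u = a * lact x phi n u.
Proof.
rewrite -[RHS]addr0 -(lact0 x n u) -lact_lin; apply: lact_ext => m w.
by rewrite addr0.
Qed.

Fact lact_sum (P : pred (edge E)) (F : edge E -> lexpr) phi n u :
  lact (\big[Add/Zero]_(e | P e) F e) phi n u = \sum_(e | P e) lact (F e) phi n u.
Proof. exact: (big_morph (fun x => lact x phi n u)). Qed.

Fact leq_rel_act x y : leq_rel x y ->
  forall phi n u, lact x phi n u = lact y phi n u.
Proof.
elim=> {x y} /=.
- by [].
- by [].
- by move=> x y z _ IHx _ IHy phi n u; rewrite IHx.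
- by move=> x x' y y' _ IHx _ IHy phi n u; rewrite IHx IHy.
- by move=> a x x' _ IHx phi n u; rewrite IHx.
- move=> x x' y y' _ IHx _ IHy phi n u.
  by rewrite IHx; apply: (@lact_ext x') => m w; rewrite IHy.
- by move=> x y z phi n u; rewrite addrA.
- by move=> x y phi n u; rewrite addrC.
- by move=> x phi n u; rewrite add0r.
- by move=> x phi n u; rewrite mulN1r addNr.
- by move=> a b x phi n u; rewrite mulrA.
- by move=> x phi n u; rewrite mul1r.
- by move=> a x y phi n u; rewrite mulrDr.
- by move=> a b x phi n u; rewrite mulrDl.
- by [].
- by [].
- by move=> x y z phi n u; rewrite lactD.
- by [].
- by move=> a x y phi n u; rewrite lactZ.
- move=> v w phi n u; case: (eqVneq v w) => [->|vw] /=; first by case: eqP.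
  by case: (eqVneq u v) => // ->; rewrite (negPf vw).
- by move=> e phi n u; case: (u == src e).
- by move=> e phi n u; rewrite eqxx.
- by move=> e phi n u; case: (u == rng e).
- by move=> e phi n u; rewrite eqxx.
- move=> e f phi n u; case: (eqVneq e f) => [<-|ef] /=.
    by rewrite eqxx modn_cons eqxx /= divn_cons; case: (eqVneq u (rng e)) => [->|].
  case: ifP => // _; case: (eqVneq (src e) (src f)) => //= sef.
  rewrite modn_cons; case: eqP => // /(rk_inj sef) ef'.
  by rewrite ef' eqxx in ef.
- move=> v /existsP [e0 /eqP se0] phi n u.
  rewrite lact_sum /=; case: (eqVneq u v) => [->|uv]; last first.
    by rewrite big1 // => e /eqP ->; rewrite (negPf uv).
  have deg_gt0 : (0 < deg v)%N.
    by rewrite -se0; apply: leq_ltn_trans (rk_lt e0).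
  have lt_nv : (n %% deg v < deg v)%N by rewrite ltn_mod.
  pose e1 := nth e0 (outs v) (n %% deg v).
  have se1 : src e1 = v.
    by have := mem_nth e0 lt_nv; rewrite mem_enum inE => /eqP.
  have rk1 : rk e1 = (n %% deg v)%N.
    by rewrite /rk se1 index_uniq ?enum_uniq.
  rewrite (bigD1 e1) ?se1 //= eqxx rk1 !eqxx /= -divn_eq big1 ?addr0 //.
  move=> e /andP [/eqP se ne]; rewrite se !eqxx /=.
  case: eqP => // rke; case/eqP: ne; apply: rk_inj; first by rewrite se.
  by rewrite -rke rk1.
Qed.

Fact lone_neq0 : lone != 0.
Proof.
apply/eqP => one0; have [v0 _] := card_gt0P (vertex_gt0 E).
have /leavitt_piP/leq_rel_act : \pi_leavitt (Vert v0) = \pi_leavitt Zero.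
  by rewrite -(lone_mul_vert v0) one0 lmul0l.
move=> /(_ (fun _ _ => 1) 0%N v0) /=; rewrite eqxx => /eqP.
by rewrite oner_eq0.
Qed.

HB.instance Definition _ := GRing.PzSemiRing_isNonZero.Build leavitt lone_neq0.
HB.instance Definition _ := GRing.Lmodule_isLalgebra.Build K leavitt lscaleAl.
HB.instance Definition _ := GRing.Lalgebra_isAlgebra.Build K leavitt lscaleAr.

End LeavittPathAlgebra.

(* Right R-modules are left modules over the converse ring R^c: the right
   action of a on x is [(a : R^c) *: x]. *)
Notation rmodType R := (lmodType R^c).

Notation free_rmod R n := ('rV[R^c]_n).

Section RingConditions.
Variable R : nzRingType.

Definition rmod_iso (M N : rmodType R) : Prop :=
  exists f : {linear M -> N}, bijective f.

Definition finitely_generated (P : rmodType R) : Prop :=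
  exists (n : nat) (g : 'I_n -> P),
    forall x : P, exists a : 'I_n -> R^c, x = \sum_(i < n) a i *: g i.

Definition projective (P : rmodType R) : Prop :=
  forall (M N : rmodType R) (g : {linear M -> N}) (f : {linear P -> N}),
    (forall y : N, exists x : M, g x = y) ->
    exists h : {linear P -> M}, forall x : P, g (h x) = f x.

Definition directly_finite : Prop := forall a b : R, a * b = 1 -> b * a = 1.

Definition stably_finite : Prop :=
  forall (n : nat) (Q : rmodType R), (0 < n)%N ->
    rmod_iso (free_rmod R n) (free_rmod R n * Q)%type -> forall x : Q, x = 0.

Definition hermite : Prop :=
  forall (m n : nat) (Q : rmodType R), (0 < m)%N -> (0 < n)%N ->
    rmod_iso (free_rmod R n) (free_rmod R m * Q)%type ->
    (m <= n)%N /\ rmod_iso Q (free_rmod R (n - m)).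

Definition cancellation_of_projectives : Prop :=
  forall P P' : rmodType R,
    finitely_generated P -> projective P ->
    finitely_generated P' -> projective P' ->
    rmod_iso (P * R^c^o)%type (P' * R^c^o)%type -> rmod_iso P P'.

End RingConditions.

(* Main.v *)
(* Write R for the Leavitt path algebra.  (1) => (2) => (3) => (4) hold over any
   nonzero ring.  If a cycle has an exit f, let c be the cycle read from the
   source u of f: then c^* c = u, whereas c c^* = u would force
   f^* = f^* c c^* = 0; adding 1 - u to c and c^* contradicts (4).

   For (5) => (1), choose all sinks and one vertex on every cycle.  These
   vertices v are orthogonal idempotents generating R as a two-sided ideal, with
   v R w = 0 for v <> w.  Each corner v R v is a (Laurent) polynomial ring in
   the cycle at v, or K at a sink: its right ideals are principal and it embeds
   in K(X).  For P finitely generated projective, P v is then a submodule of a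
   finite free v R v-module, hence free; the ranks of the P v are additive in P
   and, since the sum of the v is a full idempotent, determine P up to
   isomorphism.  So P + R ~ P' + R implies P ~ P'. *)

Require Import Defs.
From HB Require Import structures.
From mathcomp Require Import all_boot all_algebra.
From mathcomp Require Import boolp.

Set Implicit Arguments.
Unset Strict Implicit.
Unset Printing Implicit Defensive.

Import GRing.Theory.
Local Open Scope ring_scope.
Local Open Scope quotient_scope.

(** * Projective modules over an arbitrary ring *)

(** The corners are analysed without a normal form for L_K(E). A corner element is multiplied by a
    large power of one element [tau], which cancels all ghost edges and leaves a polynomial in
    [tau]. Such a power can be undone to the right of a chosen vertex, so vanishing and divisibility
    can be tested after the multiplication, and division in K[X] replaces Laurent polynomials. This
    leaves open whether distinct powers of a cycle are independent. The representation that shows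
    L_K(E) nonzero cannot tell, since there a cycle without exit fixes the indicator function of its
    vertex. If edges are first multiplied by X and ghost edges by X^-1, a cycle of length l acts on
    it by X^l, and this eigenvalue is the embedding of v R v into K(X). The same embedding makes
    ranks well defined: it turns transition matrices between bases into matrices over a field. *)

Lemma linear_pack (R : nzRingType) (U V : lmodType R) (f : U -> V) :
  linear f -> exists g : {linear U -> V}, g =1 f.
Proof.
move=> lf; pose F : {linear U -> V} := HB.pack f (GRing.isLinear.Build _ _ _ _ f lf).
by exists F.
Qed.

Section Modules.
Variable R : nzRingType.
Implicit Types (M N P Q : rmodType R).

Lemma rmod_isoP M N (f : M -> N) (g : N -> M) :
  linear f -> cancel f g -> cancel g f -> rmod_iso M N.
Proof.
move=> /linear_pack[h hE] fK gK; exists h, g => x; by rewrite hE.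
Qed.

Lemma rmod_isoE M N : rmod_iso M N ->
  exists (f : {linear M -> N}) (g : {linear N -> M}), cancel f g /\ cancel g f.
Proof.
case=> f [g fK gK].
have lg : linear g by move=> a x y; apply: (can_inj fK); rewrite linearP !gK.
by have [h hE] := linear_pack lg; exists f, h; split=> x; rewrite hE.
Qed.

Lemma rmod_iso_sym M N : rmod_iso M N -> rmod_iso N M.
Proof. by move=> /rmod_isoE[f [g [fK gK]]]; exists g, f. Qed.

Lemma rmod_iso_trans M N P : rmod_iso M N -> rmod_iso N P -> rmod_iso M P.
Proof.
move=> [f fB] [g gB]; exists (g \o f); exact: bij_comp.
Qed.

Lemma rmod_iso_prod M N P Q :
  rmod_iso M N -> rmod_iso P Q -> rmod_iso (M * P)%type (N * Q)%type.
Proof.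
move=> /rmod_isoE[f [f' [fK f'K]]] /rmod_isoE[g [g' [gK g'K]]].
apply: (@rmod_isoP _ _ (fun z => (f z.1, g z.2)) (fun z => (f' z.1, g' z.2))).
- by move=> a x y /=; congr (_, _); rewrite linearP.
- by case=> x y /=; rewrite fK gK.
- by case=> x y /=; rewrite f'K g'K.
Qed.

Lemma rmod_isoC M N : rmod_iso (M * N)%type (N * M)%type.
Proof.
by apply: (@rmod_isoP _ _ (fun z => (z.2, z.1)) (fun z => (z.2, z.1))) => [|[]|[]].
Qed.

Lemma rmod_isoA M N P : rmod_iso (M * (N * P))%type ((M * N) * P)%type.
Proof.
by apply: (@rmod_isoP _ _ (fun z => ((z.1, z.2.1), z.2.2))
  (fun z => (z.1.1, (z.1.2, z.2)))) => [|[x []]|[[]]].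
Qed.

Lemma rmod_iso_free n m :
  rmod_iso (free_rmod R (n + m)) (free_rmod R n * free_rmod R m)%type.
Proof.
apply: (@rmod_isoP _ _ (fun x => (lsubmx x, rsubmx x)) (fun z => row_mx z.1 z.2)).
- by move=> a x y /=; congr (_, _); apply/rowP => i; rewrite !mxE.
- by move=> x; rewrite hsubmxK.
- by case=> x y /=; rewrite row_mxKl row_mxKr.
Qed.

Lemma rmod_iso_free1 : rmod_iso (free_rmod R 1) R^c^o.
Proof.
apply: (@rmod_isoP (free_rmod R 1) R^c^o (fun x => x 0 0)
  (fun a => (\row_i a : free_rmod R 1))).
- by move=> a x y; rewrite !mxE.
- by move=> x; apply/rowP => i; rewrite mxE ord1.
- by move=> a; rewrite mxE.
Qed.

Lemma rmod_iso_free0 M : rmod_iso M (free_rmod R 0 * M)%type.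
Proof.
apply: (@rmod_isoP _ _ (fun x => (0, x)) snd) => //.
- by move=> a x y; rewrite -[LHS]/(0, _) -[RHS]/(_, _) /= scaler0 addr0.
- by case=> x y /=; rewrite [x]thinmx0.
Qed.

(** Combines finite generation and projectivity in one condition that does not quantify over all
    modules and passes to summands and products by explicit maps. *)
Definition free_retract P : Prop :=
  exists (n : nat) (s : {linear P -> free_rmod R n})
    (r : {linear free_rmod R n -> P}), cancel s r.

Lemma fgproj_retract P :
  finitely_generated P -> projective P -> free_retract P.
Proof.
case=> n [g gP] projP; exists n.
have [r rE] : exists r : {linear free_rmod R n -> P},
    r =1 (fun a => \sum_i a 0 i *: g i).
  apply: linear_pack => a x y; rewrite scaler_sumr -big_split; apply: eq_bigr => i _.
  by rewrite !mxE scalerDl scalerA.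
have [|s sE] := projP _ _ r idfun.
  by move=> y; have [a ->] := gP y; exists (\row_i a i); rewrite rE;
    apply: eq_bigr => i _; rewrite mxE.
by exists s, r.
Qed.

Lemma retract_fg P : free_retract P -> finitely_generated P.
Proof.
case=> n [s [r sK]]; exists n, (fun i => r (delta_mx 0 i)) => x.
exists (fun i => s x 0 i); rewrite -{1}[x]sK {1}[s x]row_sum_delta linear_sum.
by apply: eq_bigr => i _; rewrite linearZ_LR.
Qed.

Lemma retract_projective P : free_retract P -> projective P.
Proof.
case=> n [s [r sK]] M N g f g_surj.
have [y yE] := choice (fun i : 'I_n => g_surj (f (r (delta_mx 0 i)))).
have [h hE] : exists h : {linear free_rmod R n -> M},
    h =1 (fun a => \sum_i a 0 i *: y i).
  apply: linear_pack => a x z; rewrite scaler_sumr -big_split; apply: eq_bigr => i _.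
  by rewrite !mxE scalerDl scalerA.
exists (h \o s) => x /=; rewrite -{2}[x]sK [in RHS](row_sum_delta (s x)) hE !linear_sum.
by apply: eq_bigr => i _; rewrite !linearZ_LR yE.
Qed.

Lemma retract_summand n M Q :
  rmod_iso (free_rmod R n) (M * Q)%type -> free_retract Q.
Proof.
move=> /rmod_isoE[f [g [fK gK]]]; exists n.
have [s sE] : exists s : {linear Q -> free_rmod R n}, s =1 (fun x => g (0, x)).
  apply: linear_pack => a x y; rewrite -linearP; congr (g (_, _)).
  by rewrite /= scaler0 addr0.
by exists s, (snd \o f) => x; rewrite /= sE gK.
Qed.

Lemma retract_free n : free_retract (free_rmod R n).
Proof. by exists n, idfun, idfun. Qed.

Lemma retract_prod P Q :
  free_retract P -> free_retract Q -> free_retract (P * Q)%type.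
Proof.
case=> n [s [r sK]] [m [s' [r' sK']]]; exists (n + m)%N.
have [S SE] : exists S : {linear (P * Q)%type -> free_rmod R (n + m)},
    S =1 (fun z => row_mx (s z.1) (s' z.2)).
  apply: linear_pack => a x y /=; rewrite !linearP /=.
  by rewrite scale_row_mx add_row_mx.
have [T TE] : exists T : {linear free_rmod R (n + m) -> (P * Q)%type},
    T =1 (fun z => (r (lsubmx z), r' (rsubmx z))).
  by apply: linear_pack => a x y; rewrite !linearP.
by exists S, T => -[x y]; rewrite TE SE row_mxKl row_mxKr sK sK'.
Qed.

(** Copies of R are removed one at a time; the retract hypotheses keep P + R^n finitely generated
    projective at each stage. *)
Lemma cancel_free P P' n : cancellation_of_projectives R ->
  free_retract P -> free_retract P' ->
  rmod_iso (P * free_rmod R n)%type (P' * free_rmod R n)%type -> rmod_iso P P'.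
Proof.
move=> cR; elim: n => [|n IHn] rP rP' isoPP'.
  have h (M : rmodType R) : rmod_iso M (M * free_rmod R 0)%type.
    exact: rmod_iso_trans (rmod_iso_free0 M) (rmod_isoC _ _).
  exact: rmod_iso_trans (h P) (rmod_iso_trans isoPP' (rmod_iso_sym (h P'))).
have h (M : rmodType R) :
    rmod_iso (M * free_rmod R n.+1)%type ((M * free_rmod R n) * R^c^o)%type.
  apply: rmod_iso_trans _ (rmod_isoA _ _ _); apply: rmod_iso_prod.
    by exists idfun, idfun.
  rewrite -[n.+1]addn1; apply: rmod_iso_trans (rmod_iso_free _ _) _.
  by apply: rmod_iso_prod rmod_iso_free1; exists idfun, idfun.
have rn (M : rmodType R) : free_retract M -> free_retract (M * free_rmod R n)%type.
  by move=> rM; apply: retract_prod rM (retract_free n).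
apply: IHn => //; apply: cR; do ?[exact/retract_fg/rn | exact/retract_projective/rn].
exact: rmod_iso_trans (rmod_iso_sym (h P)) (rmod_iso_trans isoPP' (h P')).
Qed.

Lemma cancellation_hermite : cancellation_of_projectives R -> hermite R.
Proof.
move=> cR m n Q _ _ isoQ; have rQ := retract_summand isoQ.
have [le_mn | lt_nm] := leqP m n.
  split=> //; apply: (cancel_free cR (n := m)) => //; first exact: retract_free.
  apply: rmod_iso_trans (rmod_isoC _ _) _.
  apply: rmod_iso_trans (rmod_iso_sym isoQ) _.
  by rewrite -{1}(subnK le_mn); apply: rmod_iso_free.
(* If n < m, cancelling R^n makes R^(m-n) + Q zero, although its first factor contains a nonzero
   vector. *)
suff /rmod_isoE[f [g [fK gK]]] :
    rmod_iso (free_rmod R 0) (free_rmod R (m - n) * Q)%type.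
  have := gK (const_mx 1, 0); rewrite thinmx0 linear0 => -[/rowP/(_ (Ordinal _))].
  rewrite -subn_gt0 in lt_nm => /(_ _ lt_nm); rewrite !mxE => /esym/eqP.
  by rewrite oner_eq0.
apply: (cancel_free cR (n := n)); first exact: retract_free.
  by apply: retract_prod rQ; exact: retract_free.
apply: rmod_iso_trans (rmod_iso_sym (rmod_iso_free0 _)) _.
apply: rmod_iso_trans isoQ _.
apply: rmod_iso_trans _ (rmod_isoC _ _).
apply: rmod_iso_trans _ (rmod_iso_sym (rmod_isoA _ _ _)).
apply: rmod_iso_prod; last by exists idfun, idfun.
by rewrite -{1}(subnKC (ltnW lt_nm)); exact: rmod_iso_free.
Qed.

Lemma hermite_stably_finite : hermite R -> stably_finite R.
Proof.
move=> hR n Q n_gt0 /(hR _ _ _ n_gt0 n_gt0)[_]; rewrite subnn.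
move=> /rmod_isoE[f [g [fK _]]] x.
by rewrite -[x]fK [f x]thinmx0 linear0.
Qed.
End Modules.

(** * Kernels, and stable finiteness implies direct finiteness *)

Section Kernel.
Variables (R : nzRingType) (U V : lmodType R) (f : {linear U -> V}).

Definition linear_ker : {pred U} := fun x => f x == 0.

Fact linear_ker_closed : submod_closed linear_ker.
Proof.
split=> [|a x y]; rewrite !unfold_in ?linear0 //.
by move=> /eqP fx /eqP fy; rewrite linearP fx fy scaler0 addr0.
Qed.
HB.instance Definition _ := GRing.isSubmodClosed.Build R U linear_ker linear_ker_closed.

Record kernel := Kernel { kernel_val :> U; _ : kernel_val \in linear_ker }.
HB.instance Definition _ := [isSub for kernel_val].
HB.instance Definition _ := [Choice of kernel by <:].
HB.instance Definition _ := [SubChoice_isSubLmodule of kernel by <:].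
End Kernel.

(** Left multiplication by a is an endomorphism of the right module R, with left multiplication by b
    as a section. Hence R is isomorphic to R plus its kernel, the kernel vanishes, and it contains 1
    - b a. *)
Lemma stably_finite_directly_finite (R : nzRingType) :
  stably_finite R -> directly_finite R.
Proof.
move=> sR a b ab1.
have [f fE] : exists f : {linear R^c^o -> R^c^o}, f =1 (fun x => @GRing.mul R a x).
  apply: linear_pack => c x y; rewrite mulrDr; congr (_ + _).
  exact: (@mulrA R a x c).
pose g (x : R^c^o) : R^c^o := @GRing.mul R b x.
have gP c x y : g (c *: x + y) = c *: g x + g y.
  by rewrite /g (@mulrDr R); congr (_ + _); exact: (@mulrA R b x c).
have gK : cancel g f by move=> x; rewrite fE /g (@mulrA R) ab1 mul1r.
have kerQ (x : R^c^o) : x - g (f x) \in linear_ker f.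
  by rewrite unfold_in linearB gK subrr.
suff isoQ : rmod_iso (free_rmod R 1) (free_rmod R 1 * kernel f)%type.
  have k0 := sR 1%N (kernel f) isT isoQ (Kernel (kerQ (1 : R))).
  have := congr1 (@kernel_val _ _ _ f) k0.
  by rewrite /= fE (@mulr1 R) => /eqP; rewrite subr_eq0 => /eqP.
apply: rmod_iso_trans (rmod_iso_free1 R) _.
apply: (@rmod_iso_trans _ _ (R^c^o * kernel f)%type); last first.
  by apply: rmod_iso_prod; [exact/rmod_iso_sym/rmod_iso_free1 | exists idfun, idfun].
apply: (@rmod_isoP _ R^c^o (R^c^o * kernel f)%type (fun x => (f x, Kernel (kerQ x)))
  (fun z => g z.1 + kernel_val z.2)).
- move=> c x y; rewrite -[RHS]/(_, _); congr (_, _); first exact: linearP.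
  by apply: val_inj; rewrite /= linearP gP opprD addrACA scalerBr.
- by move=> x /=; rewrite addrC subrK.
- case=> x [y yK] /=; have fy : f y = 0 by apply/eqP.
  have fgy : f (g x + y) = x by rewrite linearD fy addr0 gK.
  by congr (_, _) => //; apply: val_inj; rewrite /= fgy addrC addKr.
Qed.

(** * Corners that are right principal ideal domains *)

(** Keeps the scalar in R, so that products appear in the order of R rather than reversed in R^c. *)
Definition ract (R : nzRingType) (P : rmodType R) (x : P) (a : R) : P :=
  (a : R^c) *: x.
Local Notation "x ** a" := (ract x a) (at level 40, left associativity).

Section RightAction.
Variable R : nzRingType.
Implicit Types (P Q : rmodType R) (a b : R).

Lemma ractM P (x : P) a b : x ** (a * b) = x ** a ** b.
Proof. by rewrite /ract scalerA. Qed.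
Lemma ractDl P (x y : P) a : (x + y) ** a = x ** a + y ** a.
Proof. exact: scalerDr. Qed.
Lemma ractNl P (x : P) a : (- x) ** a = - (x ** a).
Proof. exact: scalerN. Qed.
Lemma ractDr P (x : P) a b : x ** (a + b) = x ** a + x ** b.
Proof. exact: scalerDl. Qed.
Lemma ractNr P (x : P) a : x ** (- a) = - (x ** a).
Proof. exact: scaleNr. Qed.
Lemma ract0l P a : (0 : P) ** a = 0.
Proof. exact: scaler0. Qed.
Lemma ract0r P (x : P) : x ** 0 = 0.
Proof. exact: scale0r. Qed.
Lemma ract1 P (x : P) : x ** 1 = x.
Proof. exact: scale1r. Qed.
Lemma ract_suml P I (s : seq I) (p : pred I) (F : I -> P) a :
  (\sum_(i <- s | p i) F i) ** a = \sum_(i <- s | p i) (F i ** a).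
Proof. exact: scaler_sumr. Qed.
Lemma ract_sumr P I (s : seq I) (p : pred I) (x : P) (F : I -> R) :
  x ** (\sum_(i <- s | p i) F i) = \sum_(i <- s | p i) (x ** F i).
Proof. exact: scaler_suml. Qed.
Lemma linear_ract P Q (f : {linear P -> Q}) x a : f (x ** a) = f x ** a.
Proof. exact: linearZ_LR. Qed.
Lemma linear_ractP P Q (f : P -> Q) :
  {morph f : x y / x + y} -> (forall x a, f (x ** a) = f x ** a) -> linear f.
Proof. by move=> fD fZ a x y; rewrite fD; congr (_ + _); apply: fZ. Qed.
End RightAction.

Section Corner.
Variables (R : nzRingType) (e : R).
Implicit Types (a b : R).

(** The corner e R e is never built as a ring: its elements are written e * a * e, and its right
    ideals are subsets of R. *)
Definition corner_principal : Prop :=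
  forall I : R -> Prop, I 0 -> (forall x y, I x -> I y -> I (x - y)) ->
    (forall x, I x -> e * x * e = x) ->
    (forall x a, I x -> I (x * (e * a * e))) ->
  exists2 d, I d & forall x, I x -> exists a, x = d * (e * a * e).

Definition corner_domain : Prop :=
  forall a b, e * a * e * (e * b * e) = 0 -> e * a * e = 0 \/ e * b * e = 0.

(** A basis over e R e. A coefficient a i matters only through e * a i * e, so it is not itself
    unique in R. *)
Definition corner_basis (P : rmodType R) (N : P -> Prop) n (b : 'I_n -> P) :=
  [/\ forall i, N (b i),
      forall x, N x -> exists a : 'I_n -> R, x = \sum_i b i ** (e * a i * e)
    & forall a : 'I_n -> R, \sum_i b i ** (e * a i * e) = 0 ->
      forall i, e * a i * e = 0].

Hypothesis ee : e * e = e.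

Lemma corner_mull a : e * (e * a * e) = e * a * e.
Proof. by rewrite !mulrA ee. Qed.
Lemma corner_mulr a : (e * a * e) * e = e * a * e.
Proof. by rewrite -!mulrA ee. Qed.

(* The functionals [f] embed [N] in a free module of rank [m]; one of them maps
   [N] onto a right ideal that is zero or free of rank one, hence splits off. *)
Lemma corner_submod_basis (P : rmodType R) m (f : 'I_m -> {linear P -> R^c^o})
    (N : P -> Prop) :
  corner_principal -> corner_domain ->
  N 0 -> (forall x y, N x -> N y -> N (x - y)) ->
  (forall x a, N x -> N (x ** (e * a * e))) ->
  (forall x i, N x -> e * f i x * e = f i x) ->
  (forall x, N x -> (forall i, f i x = 0) -> x = 0) ->
  exists n (b : 'I_n -> P), corner_basis N b.
Proof.
move=> princ dom; elim: m f N => [|m IHm] f N N0 NB NZ fN injf.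
  exists 0%N, (fun=> 0); split=> [[]//|x Nx|_ _ []//].
  by exists (fun=> 0); rewrite big_ord0; apply: injf => // -[].
have fZ i x a : f i (x ** a) = (f i x : R) * a by rewrite linear_ract.
pose I (a : R) := exists2 x, N x & f ord0 x = a.
have [||||d [y Ny fy] dP] := princ I.
- by exists 0 => //; rewrite linear0.
- by move=> _ _ [x Nx <-] [z Nz <-]; exists (x - z); [exact: NB | rewrite linearB].
- by move=> _ [x Nx <-]; exact: fN.
- by move=> _ a [x Nx <-]; exists (x ** (e * a * e)); [exact: NZ | exact: fZ].
have dE : e * d * e = d by rewrite -fy fN.
pose N' x := N x /\ f ord0 x = 0.
have [|||||n [b [bN' bspan bfree]]] := IHm (fun i => f (lift ord0 i)) N'.
- by split=> //; rewrite linear0.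
- by move=> x z [Nx fx] [Nz fz]; split; [exact: NB | rewrite linearB fx fz subrr].
- by move=> x a [Nx fx]; split; [exact: NZ | rewrite fZ fx mul0r].
- by move=> x i [Nx _]; exact: fN.
- move=> x [Nx fx] fx'; apply: injf => // i.
  by case: (unliftP ord0 i) => [j ->|->].
have fb i : f ord0 (b i) = 0 by have [] := bN' i.
have [d0|d_neq0] := eqVneq d 0.
  exists n, b; split=> // [i|x Nx]; first by have [] := bN' i.
  apply: bspan; split=> //; have [|a ->] := dP (f ord0 x); first by exists x.
  by rewrite d0 mul0r.
exists n.+1, (fun i => oapp b y (unlift ord0 i)); split=> [i|x Nx|a].
- by case: unliftP => [j _|_] //=; have [] := bN' j.
- have [|a fx] := dP (f ord0 x); first by exists x.
  have [|c xE] := bspan (x - y ** (e * a * e)).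
    split; first by apply: NB => //; exact: NZ.
    by rewrite linearB fZ fy fx subrr.
  exists (fun i => oapp c a (unlift ord0 i)).
  rewrite big_ord_recl unlift_none /=; apply/eqP; rewrite addrC -subr_eq xE.
  by apply/eqP/eq_bigr => i _; rewrite liftK.
rewrite big_ord_recl unlift_none /= => sum0.
have sumE : \sum_(i < n) oapp b y (unlift ord0 (lift ord0 i)) **
    (e * a (lift ord0 i) * e) = \sum_(i < n) b i ** (e * a (lift ord0 i) * e).
  by apply: eq_bigr => i _; rewrite liftK.
rewrite sumE in sum0.
have a0 : e * a ord0 * e = 0.
  have := congr1 (f ord0) sum0.
  rewrite linearD fZ fy linear_sum linear0 big1 ?addr0 => [|i _]; last first.
    by rewrite fZ fb mul0r.
  rewrite -dE => /dom[|//]; rewrite dE => d0.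
  by rewrite d0 eqxx in d_neq0.
rewrite a0 ract0r add0r in sum0 => i.
by case: (unliftP ord0 i) => [j ->|-> //]; exact: (bfree (fun j => a (lift ord0 j))).
Qed.

Lemma corner_basis_inj (P : rmodType R) (N : P -> Prop) n (b : 'I_n -> P)
    (a c : 'I_n -> R) :
  corner_basis N b ->
  \sum_i b i ** (e * a i * e) = \sum_i b i ** (e * c i * e) ->
  forall i, e * a i * e = e * c i * e.
Proof.
case=> _ _ bfree eq_ac i; apply/eqP; rewrite -subr_eq0 -mulrBl -mulrBr; apply/eqP.
apply: (bfree (fun i => a i - c i)).
rewrite -[RHS](subrr (\sum_i b i ** (e * a i * e))) [in X in _ = _ - X]eq_ac -sumrB.
by apply: eq_bigr => j _; rewrite mulrBr mulrBl ractDr ractNr.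
Qed.

(** The map th, multiplicative on the corner only, sends the transition matrices between b and c to
    matrices over F with MA MB = 1, and rank over a field gives the bound. Right coefficients
    compose in the opposite order, which commutativity of F repairs. *)
Lemma corner_basis_le (F : fieldType) (th : {additive R -> F})
    (P : rmodType R) (N : P -> Prop) m n (b : 'I_m -> P) (c : 'I_n -> P) :
  th e = 1 ->
  (forall a b, th (e * a * e * (e * b * e)) = th (e * a * e) * th (e * b * e)) ->
  (forall x, N x -> x ** e = x) ->
  corner_basis N b -> corner_basis N c -> (m <= n)%N.
Proof.
move=> th1 thM Ne bB cB; have [bN bspan _] := bB; have [cN cspan _] := cB.
have [A AE] := choice (fun i => cspan _ (bN i)).
have [B BE] := choice (fun i => bspan _ (cN i)).
pose MA := \matrix_(i < m, j < n) th (e * A i j * e).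
pose MB := \matrix_(j < n, i < m) th (e * B j i * e).
suff MAB : MA *m MB = 1%:M.
  rewrite -(mxrank1 F m) -MAB; apply: leq_trans (mxrankM_maxl _ _) _.
  exact: rank_leq_col.
apply/matrixP => i k; rewrite !mxE.
(* Two expansions of b i in the basis b are compared: the one passing through c, and b i itself. *)
have := @corner_basis_inj _ _ _ b (fun k => \sum_j e * B j k * e * (e * A i j * e))
  (fun k => (i == k)%:R) bB.
move=> /(_ _ k) E; transitivity (th (e * (i == k)%:R * e)); last first.
  by case: eqP => _; rewrite ?mulr1 ?ee ?th1 // mulr0 mul0r raddf0.
rewrite -E => [|{k E}].
  rewrite mulr_sumr mulr_suml raddf_sum; apply: eq_bigr => j _.
  by rewrite mulrA corner_mull -mulrA corner_mulr thM !mxE mulrC.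
rewrite [RHS](bigD1 i) //= eqxx mulr1 ee Ne //.
rewrite [X in _ = _ + X]big1 ?addr0 => [|k]; last first.
  by rewrite eq_sym => /negPf ->; rewrite mulr0 mul0r ract0r.
rewrite {1}[b i]AE.
under [RHS]eq_bigr => j _ do rewrite [c j]BE ract_suml.
rewrite exchange_big; apply: eq_bigr => k _ /=.
under [in RHS]eq_bigr => j _ do rewrite -ractM.
rewrite -ract_sumr; congr (_ ** _).
rewrite mulr_sumr mulr_suml; apply: eq_bigr => j _.
by rewrite mulrA corner_mull -mulrA corner_mulr.
Qed.

Lemma corner_basis_iso (P Q : rmodType R) (f : {linear P -> Q})
    (g : {linear Q -> P}) n (b : 'I_n -> P) :
  cancel f g -> cancel g f ->
  corner_basis (fun x => x ** e = x) b -> corner_basis (fun x => x ** e = x) (f \o b).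
Proof.
move=> fK gK [bN bspan bfree].
have fE (a : 'I_n -> R) :
    \sum_i f (b i) ** (e * a i * e) = f (\sum_i b i ** (e * a i * e)).
  by rewrite linear_sum; apply: eq_bigr => i _; rewrite linear_ract.
split=> [i|y yN|a] /=.
- by rewrite -linear_ract bN.
- have [|a gy] := bspan (g y); first by rewrite -linear_ract yN.
  by exists a; rewrite fE -gy gK.
- by rewrite fE => f0; apply: bfree; rewrite -[LHS]fK f0 linear0.
Qed.

Lemma corner_basis_prod (P Q : rmodType R) m n (b : 'I_m -> P) (c : 'I_n -> Q) :
  corner_basis (fun x => x ** e = x) b -> corner_basis (fun x => x ** e = x) c ->
  corner_basis (fun x : (P * Q)%type => x ** e = x)
    (fun i => match split i with inl j => (b j, 0) | inr k => (0, c k) end).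
Proof.
move=> [bN bspan bfree] [cN cspan cfree].
have pE (x : P) (y : Q) a : (x, y) ** a = (x ** a, y ** a) by [].
have splitl j : split (lshift n j) = inl j :> 'I_m + 'I_n := unsplitK (inl j).
have splitr j : split (rshift m j) = inr j :> 'I_m + 'I_n := unsplitK (inr j).
have sumE (a : 'I_(m + n) -> R) :
    \sum_i match split i with inl j => (b j, 0) | inr k => (0, c k) end
      ** (e * a i * e)
    = (\sum_i b i ** (e * a (lshift n i) * e), \sum_i c i ** (e * a (rshift m i) * e)).
  rewrite big_split_ord /=.
  under eq_bigr => i _ do rewrite splitl pE ract0l.
  under [X in _ + X]eq_bigr => i _ do rewrite splitr pE ract0l.
  have -> (F : 'I_m -> P) : \sum_i (F i, 0 : Q) = (\sum_i F i, 0).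
    apply: (big_rec2 (fun z x => z = (x, 0))) => // i x z _ ->.
    by rewrite -[LHS]/(_, _) /= addr0.
  have -> (F : 'I_n -> Q) : \sum_i (0 : P, F i) = (0, \sum_i F i).
    apply: (big_rec2 (fun z x => z = (0, x))) => // i x z _ ->.
    by rewrite -[LHS]/(_, _) /= addr0.
  by rewrite -[LHS]/(_, _) /= addr0 add0r.
split=> [i|[x y] /pair_equal_spec[xN yN]|a].
- by case: (split i) => j; rewrite pE ract0l (bN, cN).
- have [a xE] := bspan x xN; have [a' yE] := cspan y yN.
  exists (fun i => match split i with inl j => a j | inr k => a' k end).
  rewrite sumE xE yE; congr (_, _); apply: eq_bigr => i _; rewrite ?splitl ?splitr //.
- rewrite sumE => /pair_equal_spec[a0 a'0] i; rewrite -[i]splitK.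
  case: (split i) => j /=; first exact: (bfree (fun j => a (lshift n j))).
  exact: (cfree (fun j => a (rshift m j))).
Qed.
End Corner.

(* Half of the Morita equivalence between a ring and a full corner: the
   functor P |-> P e reflects isomorphism. *)
Section FullCorner.
Variables (R : nzRingType) (e : R) (n : nat) (a b : 'I_n -> R).
Hypotheses (ee : e * e = e) (full : \sum_i a i * e * b i = 1).

Section Extension.
Variables (P Q : rmodType R) (phi : P -> Q).
Hypothesis phiD : {morph phi : x y / x + y}.
Hypothesis phiZ : forall x r, phi (x ** (e * r * e)) = phi x ** (e * r * e).
Hypothesis phie : forall x, phi (x ** e) = phi x.

(** As x is the sum of the x a_i e b_i, no other linear extension of phi from P e is possible. By
    [phie], phi reads x only through x e, so it stands for a map on P e. *)
Definition corner_extend (x : P) : Q := \sum_i phi (x ** a i) ** b i.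

Fact corner_map0 : phi 0 = 0.
Proof. by apply: (addrI (phi 0)); rewrite -phiD !addr0. Qed.

Fact corner_map_sum m (F : 'I_m -> P) : phi (\sum_i F i) = \sum_i phi (F i).
Proof. exact: (big_morph phi phiD corner_map0). Qed.

Fact corner_map_fix x : phi x ** e = phi x.
Proof. by have := phiZ x 1; rewrite mulr1 ee phie. Qed.

(** Inserting [full] a second time, after b_i r, produces the corner elements e b_i r a_k e. These
    can be moved inside phi, where the sum over i collapses by [full]. *)
Lemma corner_extend_linear : linear corner_extend.
Proof.
apply: linear_ractP => [x y|x r].
  by rewrite -big_split; apply: eq_bigr => i _; rewrite ractDl phiD ractDl.
rewrite [RHS]ract_suml.
transitivity (\sum_i \sum_k phi (x ** a i) ** (b i * r * a k * e * b k)); last first.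
  apply: eq_bigr => i _; rewrite -ractM -ract_sumr; congr (_ ** _).
  rewrite -[X in _ = X]mulr1 -full mulr_sumr; apply: eq_bigr => k _.
  by rewrite !mulrA.
rewrite exchange_big; apply: eq_bigr => k _ /=.
have step i : phi (x ** a i) ** (b i * r * a k * e * b k)
    = phi (x ** (a i * e * b i * r * a k * e)) ** b k.
  rewrite ractM; congr (_ ** b k).
  have := phiZ (x ** a i) (b i * r * a k).
  rewrite -[phi (x ** a i)]corner_map_fix -!ractM.
  by rewrite !mulrA ee => ->.
under [in RHS]eq_bigr => i _ do rewrite step.
rewrite -ract_suml -corner_map_sum -ract_sumr -!mulr_suml full mul1r.
by rewrite !ractM phie.
Qed.

Lemma corner_extend_fix x : phi (x ** e) = corner_extend (x ** e).
Proof.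
transitivity (\sum_i phi x ** (e * a i * e) ** b i).
  under eq_bigr => i _ do rewrite -ractM -(mulrA e) -(mulrA e).
  by rewrite -ract_sumr -mulr_sumr full mulr1 phie corner_map_fix.
by apply: eq_bigr => i _; rewrite -phiZ ractM phie ractM.
Qed.
End Extension.

Lemma corner_extend_iso (P Q : rmodType R) (phi : P -> Q) (psi : Q -> P) :
  {morph phi : x y / x + y} -> {morph psi : x y / x + y} ->
  (forall x r, phi (x ** (e * r * e)) = phi x ** (e * r * e)) ->
  (forall x r, psi (x ** (e * r * e)) = psi x ** (e * r * e)) ->
  (forall x, phi (x ** e) = phi x) -> (forall y, psi (y ** e) = psi y) ->
  (forall x, psi (phi x) = x ** e) -> (forall y, phi (psi y) = y ** e) ->
  rmod_iso P Q.
Proof.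
move=> phiD psiD phiZ psiZ phie psie psiK phiK.
have [f fE] := linear_pack (corner_extend_linear phiD phiZ phie).
have [g gE] := linear_pack (corner_extend_linear psiD psiZ psie).
apply: (@rmod_isoP _ _ _ f g) => [|x|y].
- by move=> r x y; rewrite linearP.
- rewrite gE /corner_extend -[RHS]ract1 -full ract_sumr; apply: eq_bigr => k _.
  rewrite -linear_ract -psie -linear_ract fE -corner_extend_fix // psiK.
  by rewrite !ractM -(ractM _ e e) ee.
- rewrite fE /corner_extend -[RHS]ract1 -full ract_sumr; apply: eq_bigr => k _.
  rewrite -linear_ract -phie -linear_ract gE -corner_extend_fix // phiK.
  by rewrite !ractM -(ractM _ e e) ee.
Qed.
End FullCorner.

(** * Orthogonal corners: projective modules are classified by their ranks *)

Section OrthogonalCorners.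
Variables (R : nzRingType) (F : fieldType) (I : finType) (v : I -> R).
Variables (n : nat) (a b : 'I_n -> R) (th : I -> {additive R -> F}).
Hypothesis v_idem : forall i, v i * v i = v i.
Hypothesis v_orth : forall i j x, i != j -> v i * x * v j = 0.
Hypothesis full : \sum_k a k * (\sum_i v i) * b k = 1.
Hypothesis princ : forall i, corner_principal (v i).
Hypothesis th1 : forall i, th i (v i) = 1.
Hypothesis thM : forall i x y, th i (v i * x * v i * (v i * y * v i))
  = th i (v i * x * v i) * th i (v i * y * v i).
Hypothesis th_inj : forall i x, th i (v i * x * v i) = 0 -> v i * x * v i = 0.

Local Notation fixed i := (fun x => x ** v i = x).
Local Notation e := (\sum_i v i).

Fact orth_corner_domain i : corner_domain (v i).
Proof.
move=> x y xy0; have := thM i x y; rewrite xy0 raddf0 => /esym/eqP.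
by rewrite mulf_eq0 => /orP[] /eqP /th_inj; [left | right].
Qed.

Fact orth_mul i j : i != j -> v i * v j = 0.
Proof. by move=> ij; rewrite -[v i]mulr1 v_orth. Qed.

Fact orth_mul_sum i : v i * e = v i.
Proof.
rewrite mulr_sumr (bigD1 i) //= v_idem big1 ?addr0 // => j ji.
by rewrite orth_mul // eq_sym.
Qed.

Fact sum_mul_orth i : e * v i = v i.
Proof.
rewrite mulr_suml (bigD1 i) //= v_idem big1 ?addr0 // => j ji.
by rewrite orth_mul.
Qed.

Fact sum_orth_idem : e * e = e.
Proof. by rewrite mulr_suml; apply: eq_bigr => i _; exact: orth_mul_sum. Qed.

(** By [v_orth] the corner of e is the product of the corners of the v i; this is the projection to
    one factor. *)
Fact sum_corner_orth r i : e * r * e * v i = v i * r * v i.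
Proof.
rewrite -mulrA sum_mul_orth !mulr_suml (bigD1 i) //= big1 ?addr0 // => j ji.
by rewrite v_orth.
Qed.

(** The splitting s embeds P v_i in a power of R v_i, whose entries need not lie in v_i R v_i. Left
    multiplication by the v_i b_j moves them there, and loses nothing because of [full] and
    orthogonality. *)
Lemma retract_corner_basis (P : rmodType R) i : free_retract P ->
  exists m (c : 'I_m -> P), corner_basis (v i) (fixed i) c.
Proof.
case=> N [s [r sK]].
pose J : finType := ('I_N * 'I_n)%type.
have fP (z : J) : exists f : {linear P -> R^c^o},
    f =1 (fun x => v i * b z.2 * (s x 0 z.1 : R)).
  apply: linear_pack; apply: linear_ractP => [x y|x c].
    by rewrite linearD mxE; exact: (@mulrDr R).
  by rewrite linear_ract mxE; exact: (@mulrA R).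
have [f fE] := choice fP.
have sZ x c k : s (x ** c) 0 k = (s x 0 k : R) * c by rewrite linear_ract mxE.
apply: (@corner_submod_basis R (v i) P #|J| (fun k => f (enum_val k)) (fixed i)).
- exact: princ.
- exact: orth_corner_domain.
- exact: ract0l.
- by move=> x y xE yE; rewrite ractDl ractNl xE yE.
- by move=> x c xE; rewrite -ractM corner_mulr.
- by move=> x k xE; rewrite fE !mulrA v_idem -mulrA -sZ xE.
move=> x xE fx0; rewrite -[x]sK; suff -> : s x = 0 by rewrite linear0.
apply/rowP => k; rewrite mxE -xE sZ.
have [sx sxE] : exists y : R, y = s x 0 k by exists (s x 0 k).
rewrite -sxE -[sx]mul1r -full !mulr_suml big1 // => j _.
suff vb0 : v i * (b j * sx) * v i = 0.
  rewrite -!mulrA (_ : e * _ = 0) ?mulr0 // !mulrA -(mulrA e).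
  rewrite -[RHS]vb0 mulr_suml mulr_suml (bigD1 i) //= big1 ?addr0 // => l li.
  by rewrite v_orth.
have := fx0 (enum_rank (k, j)); rewrite fE enum_rankK /= -sxE !mulrA => ->.
by rewrite mul0r.
Qed.

Lemma corner_rank_uniq (P Q : rmodType R) i m m' (c : 'I_m -> P) (c' : 'I_m' -> Q) :
  rmod_iso P Q ->
  corner_basis (v i) (fixed i) c -> corner_basis (v i) (fixed i) c' -> m = m'.
Proof.
move=> /rmod_isoE[f [g [fK gK]]] /(corner_basis_iso fK gK) cB c'B.
by apply/eqP; rewrite eqn_leq !(corner_basis_le (v_idem i) (th1 i) (@thM i) _ cB c'B,
  corner_basis_le (v_idem i) (th1 i) (@thM i) _ c'B cB).
Qed.

(** phi copies coordinates from the bases c to the bases d. The coordinates are chosen arbitrarily,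
    so the last clause is stated for every choice of them. *)
Lemma corner_basis_transfer (P Q : rmodType R) (m : I -> nat)
    (c : forall i, 'I_(m i) -> P) (d : forall i, 'I_(m i) -> Q) :
  (forall i, corner_basis (v i) (fixed i) (@c i)) ->
  (forall i, corner_basis (v i) (fixed i) (@d i)) ->
  exists phi : P -> Q, [/\ {morph phi : x y / x + y},
    forall x r, phi (x ** (e * r * e)) = phi x ** (e * r * e),
    forall x, phi (x ** e) = phi x
  & forall x i (r : 'I_(m i) -> R), x ** v i = \sum_k c i k ** (v i * r k * v i) ->
     phi x ** v i = \sum_k d i k ** (v i * r k * v i)].
Proof.
move=> cB dB.
have cN i k : c i k ** v i = c i k by have [cN _ _] := cB i; exact: cN.
have dN i k : d i k ** v i = d i k by have [dN _ _] := dB i; exact: dN.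
have coordP i x : exists r : 'I_(m i) -> R,
    x ** v i = \sum_k c i k ** (v i * r k * v i).
  by have [_ cspan _] := cB i; apply: cspan; rewrite -ractM v_idem.
pose r i x := projT1 (cid (coordP i x)).
have rE i x : x ** v i = \sum_k c i k ** (v i * r i x k * v i).
  by rewrite /r; case: cid.
pose phi x := \sum_i \sum_k d i k ** (v i * r i x k * v i).
have phiE x i (s : 'I_(m i) -> R) : x ** v i = \sum_k c i k ** (v i * s k * v i) ->
    phi x ** v i = \sum_k d i k ** (v i * s k * v i).
  move=> xE; rewrite ract_suml (bigD1 i) //=.
  rewrite [X in _ + X]big1 ?addr0 => [|j ji]; last first.
    rewrite ract_suml big1 // => k _.
    by rewrite -ractM -(mulrA _ (v j)) orth_mul ?mulr0 ?ract0r.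
  rewrite ract_suml; apply: eq_bigr => k _; rewrite -ractM corner_mulr //.
  congr (_ ** _); apply: (corner_basis_inj (cB i)).
  by rewrite -rE.
have phi_e x : phi x ** e = phi x.
  rewrite ract_sumr; apply: eq_bigr => i _; rewrite (phiE _ _ (r i x)) //.
have phi_ext x y : (forall i, phi x ** v i = phi y ** v i) -> phi x = phi y.
  by move=> xy; rewrite -(phi_e x) -(phi_e y) !ract_sumr; apply: eq_bigr.
exists phi; split=> //.
- move=> x y; rewrite -[LHS]phi_e -[X in _ = X + _]phi_e -[X in _ = _ + X]phi_e.
  rewrite -ractDl !ract_sumr; apply: eq_bigr => i _.
  rewrite ractDl (phiE x i (r i x)) // (phiE y i (r i y)) // -big_split /=.
  rewrite (phiE (x + y) i (fun k => r i x k + r i y k)).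
    by apply: eq_bigr => k _; rewrite mulrDr mulrDl ractDr.
  rewrite ractDl !rE -big_split /=; apply: eq_bigr => k _.
  by rewrite mulrDr mulrDl ractDr.
- move=> x s; rewrite -[LHS]phi_e.
  rewrite -[RHS](_ : phi x ** (e * s * e) ** e = _); last first.
    by rewrite -ractM -mulrA sum_orth_idem.
  rewrite [LHS]ract_sumr [RHS]ract_sumr.
  apply: eq_bigr => i _; rewrite -[RHS]ractM sum_corner_orth.
  have vE (M : rmodType R) (y : M) :
      y ** (v i * s * v i) = y ** v i ** (v i * s * v i).
    by rewrite -ractM !mulrA v_idem.
  have vM (M : rmodType R) (y : M) t : y ** (v i * t * v i) ** (v i * s * v i)
      = y ** (v i * (t * v i * s) * v i).
    by rewrite -ractM; congr (_ ** _); rewrite !mulrA -(mulrA _ (v i) (v i)) v_idem.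
  rewrite vE (phiE x i (r i x)) // (phiE _ _ (fun k => r i x k * v i * s)).
    by rewrite ract_suml; apply: eq_bigr => k _; rewrite vM.
  by rewrite -ractM sum_corner_orth vE rE ract_suml; apply: eq_bigr => k _; rewrite vM.
- move=> x; apply: phi_ext => i.
  by rewrite (phiE _ _ (r i x)) ?(phiE _ _ (r i x)) // -ractM sum_mul_orth.
Qed.

Lemma corner_basis_rmod_iso (P Q : rmodType R) (m : I -> nat)
    (c : forall i, 'I_(m i) -> P) (d : forall i, 'I_(m i) -> Q) :
  (forall i, corner_basis (v i) (fixed i) (@c i)) ->
  (forall i, corner_basis (v i) (fixed i) (@d i)) -> rmod_iso P Q.
Proof.
move=> cB dB.
have [phi [phiD phiZ phie phiE]] := corner_basis_transfer cB dB.
have [psi [psiD psiZ psie psiE]] := corner_basis_transfer dB cB.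
have coord (M : rmodType R) (f : forall i, 'I_(m i) -> M) x i :
    (forall i, corner_basis (v i) (fixed i) (@f i)) ->
    exists r : 'I_(m i) -> R, x ** v i = \sum_k f i k ** (v i * r k * v i).
  by move=> fB; have [_ fspan _] := fB i; apply: fspan; rewrite -ractM v_idem.
apply: (corner_extend_iso sum_orth_idem full phiD psiD phiZ psiZ phie psie) => x.
- rewrite -(corner_map_fix sum_orth_idem psiZ psie) !ract_sumr; apply: eq_bigr => i _.
  have [r xE] := coord _ c x i cB.
  by rewrite xE (psiE _ _ r) ?(phiE _ _ r).
- rewrite -(corner_map_fix sum_orth_idem phiZ phie) !ract_sumr; apply: eq_bigr => i _.
  have [r xE] := coord _ d x i dB.
  by rewrite xE (phiE _ _ r) ?(psiE _ _ r).
Qed.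

Theorem orthogonal_corners_cancellation : cancellation_of_projectives R.
Proof.
move=> P P' Pfg Pproj P'fg P'proj isoPP'.
have rP := fgproj_retract Pfg Pproj; have rP' := fgproj_retract P'fg P'proj.
have rR : free_retract R^c^o.
  have [f [g [fK gK]]] := rmod_isoE (rmod_iso_free1 R).
  by exists 1%N, g, f.
have [m mB] := choice (fun i => retract_corner_basis i rP).
have [m' mB'] := choice (fun i => retract_corner_basis i rP').
have mm' : m = m'.
  apply: functional_extensionality_dep => i.
  have [c cB] := mB i; have [c' c'B] := mB' i.
  (* l is the rank of R itself at v i; it is the common summand to be cancelled. *)
  have [l [d dB]] := retract_corner_basis i rR.
  apply: (@addIn l).
  exact: corner_rank_uniq isoPP' (corner_basis_prod cB dB) (corner_basis_prod c'B dB).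
rewrite -{m'}mm' in mB'.
pose c i := projT1 (cid (mB i)); pose c' i := projT1 (cid (mB' i)).
apply: (@corner_basis_rmod_iso _ _ m c c') => i.
  by rewrite /c; case: cid.
by rewrite /c'; case: cid.
Qed.
End OrthogonalCorners.

(** * Monomials of a Leavitt path algebra *)

Section Generators.
Variables (K : fieldType) (E : finGraph).
Local Notation L := (leavitt K E).
Implicit Types (v w : vertex E) (e f : edge E) (p q : seq (edge E)).

Definition vt v : L := \pi_(leavitt K E) (Vert K v).
Definition ed e : L := \pi_(leavitt K E) (Edge K e).
Definition gh e : L := \pi_(leavitt K E) (Ghost K e).

Lemma leavitt_piM x y :
  \pi_(leavitt K E) (Mul x y) = \pi_(leavitt K E) x * \pi_(leavitt K E) y :> L.
Proof. by rewrite -lmul_pi. Qed.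

Lemma leavitt_pi_eq x y : leq_rel x y ->
  \pi_(leavitt K E) x = \pi_(leavitt K E) y.
Proof. by move/leavitt_piP. Qed.

Lemma leavitt_piD x y :
  \pi_(leavitt K E) (Add x y) = \pi_(leavitt K E) x + \pi_(leavitt K E) y :> L.
Proof. by rewrite -ladd_pi. Qed.

Lemma leavitt_piZ a x :
  \pi_(leavitt K E) (Scale a x) = a *: (\pi_(leavitt K E) x : L).
Proof. by rewrite -lscale_pi. Qed.

Lemma leavitt_ind (P : L -> Prop) :
  (forall v, P (vt v)) -> (forall e, P (ed e)) -> (forall e, P (gh e)) ->
  P 0 -> (forall x y, P x -> P y -> P (x + y)) ->
  (forall a x, P x -> P (a *: x)) -> (forall x y, P x -> P y -> P (x * y)) ->
  forall x, P x.
Proof.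
move=> Pv Pe Pg P0 PD PZ PM; elim/quotW; elim=> // [x IHx y IHy|a x IHx|x IHx y IHy].
- by rewrite leavitt_piD; apply: PD.
- by rewrite leavitt_piZ; apply: PZ.
- by rewrite leavitt_piM; apply: PM.
Qed.

Lemma vt_vt v w : vt v * vt w = if v == w then vt w else 0.
Proof. by rewrite -leavitt_piM (leavitt_pi_eq (LVert K v w)); case: eqP. Qed.

Lemma vt_idem v : vt v * vt v = vt v.
Proof. by rewrite vt_vt eqxx. Qed.

Lemma vt_ed v e : vt v * ed e = if v == src e then ed e else 0.
Proof.
have edE : ed e = vt (src e) * ed e.
  by rewrite -leavitt_piM; apply/esym/leavitt_piP; exact: LSrcEdge.
by rewrite edE mulrA vt_vt; case: eqP => _; rewrite ?mul0r // -edE.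
Qed.

Lemma ed_vt e v : ed e * vt v = if rng e == v then ed e else 0.
Proof.
have edE : ed e = ed e * vt (rng e).
  by rewrite -leavitt_piM; apply/esym/leavitt_piP; exact: LEdgeRng.
by rewrite edE -mulrA vt_vt; case: eqP => [<-|_]; rewrite ?mulr0 // -edE.
Qed.

Lemma vt_gh v e : vt v * gh e = if v == rng e then gh e else 0.
Proof.
have ghE : gh e = vt (rng e) * gh e.
  by rewrite -leavitt_piM; apply/esym/leavitt_piP; exact: LRngGhost.
by rewrite ghE mulrA vt_vt; case: eqP => _; rewrite ?mul0r // -ghE.
Qed.

Lemma gh_vt e v : gh e * vt v = if src e == v then gh e else 0.
Proof.
have ghE : gh e = gh e * vt (src e).
  by rewrite -leavitt_piM; apply/esym/leavitt_piP; exact: LGhostSrc.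
by rewrite ghE -mulrA vt_vt; case: eqP => [<-|_]; rewrite ?mulr0 // -ghE.
Qed.

Lemma gh_ed e f : gh e * ed f = if e == f then vt (rng e) else 0.
Proof.
by rewrite -leavitt_piM (leavitt_pi_eq (LGhostEdge K e f)); case: eqP.
Qed.

Lemma vt_regular v : regular v -> vt v = \sum_(e | src e == v) ed e * gh e.
Proof.
move=> vreg; rewrite /vt (leavitt_pi_eq (LRegular K vreg)).
rewrite (big_morph _ leavitt_piD (erefl : \pi_(leavitt K E) (Zero K E) = 0)).
by apply: eq_bigr => e _; rewrite leavitt_piM.
Qed.

Lemma sum_vt : \sum_v vt v = 1.
Proof. by []. Qed.

Lemma vt_neq0 v : vt v != 0.
Proof.
apply/eqP => /leavitt_piP/leq_rel_act/(_ (fun _ _ => 1) 0%N v)/=/eqP.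
by rewrite eqxx oner_eq0.
Qed.

(** The empty path gives 1 and not a vertex, which is why the monomials below carry an explicit
    vertex. *)
Definition edp p : L := \prod_(e <- p) ed e.
Definition ghp p : L := \prod_(e <- rev p) gh e.

Lemma edp_cons e p : edp (e :: p) = ed e * edp p.
Proof. exact: big_cons. Qed.
Lemma edp_rcons p e : edp (rcons p e) = edp p * ed e.
Proof. by rewrite /edp -cats1 big_cat big_seq1. Qed.
Lemma ghp_cons e p : ghp (e :: p) = ghp p * gh e.
Proof. by rewrite /ghp rev_cons -cats1 big_cat big_seq1. Qed.
Lemma edp_nil : edp [::] = 1. Proof. exact: big_nil. Qed.
Lemma ghp_nil : ghp [::] = 1. Proof. exact: big_nil. Qed.

Lemma ghp_edp e p : path (@composable E) e p ->
  ghp (e :: p) * edp (e :: p) = vt (rng (last e p)).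
Proof.
elim: p e => [|f p IHp] e /=.
  by rewrite ghp_cons edp_cons edp_nil ghp_nil mul1r mulr1 gh_ed eqxx.
move=> /andP[/eqP ef fp]; rewrite ghp_cons edp_cons mulrA -(mulrA _ _ (ed e)).
rewrite gh_ed eqxx -mulrA {1}edp_cons (mulrA (vt _)) vt_ed ef eqxx -edp_cons.
exact: IHp.
Qed.

Lemma directly_finite_no_exit : directly_finite L -> no_exit E.
Proof.
move=> dfL p /andP[/andP[_ p_cyc] _] [f /existsP[e /and3P[/rot_to[i q pE] /eqP sf fe]]].
rewrite -(rot_cycle i) pE /= rcons_path in p_cyc.
have {p_cyc} /andP[qP /eqP qe] := p_cyc.
pose c := edp (e :: q); pose d := ghp (e :: q); pose u := vt (src e).
have dc : d * c = u by rewrite /d ghp_edp // qe.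
have uc : u * c = c by rewrite /c edp_cons mulrA vt_ed eqxx.
have du : d * u = d by rewrite /d ghp_cons -mulrA gh_vt eqxx.
have cu : c * u = c.
  rewrite /c (lastI e q) edp_rcons -mulrA ed_vt.
  by rewrite qe eqxx.
have ud : u * d = d.
  rewrite /d /ghp (lastI e q) rev_rcons big_cons mulrA vt_gh.
  by rewrite -qe eqxx.
have uu : u * u = u by exact: vt_idem.
have corner_unit (x y : L) : x * u = x -> u * y = y ->
    (x + (1 - u)) * (y + (1 - u)) = x * y + (1 - u).
  move=> xu uy; rewrite !mulrDl !mulrDr !mulr1 !mul1r !mulrN !mulNr xu uy uu.
  by rewrite subrr opprK addNr !addr0 [_ - y]addrC addKr.
have /dfL : (d + (1 - u)) * (c + (1 - u)) = 1.
  by rewrite corner_unit // dc addrC subrK.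
rewrite corner_unit // => /eqP.
rewrite eq_sym -subr_eq opprB addrC subrK => /eqP/esym cd.
have ghf : gh f = 0.
  have /esym -> : gh f * u = gh f by rewrite gh_vt sf eqxx.
  by rewrite -cd mulrA /c edp_cons mulrA gh_ed (negPf fe) !mul0r.
have := gh_ed f f; rewrite eqxx ghf mul0r => /esym/eqP.
by rewrite (negPf (vt_neq0 _)).
Qed.
End Generators.

(** * Recurrent vertices of a no-exit graph *)

Section Graph.
Variable E : finGraph.
Implicit Types (u v w : vertex E) (e f : edge E).

Definition adj : rel (vertex E) := [rel u w | [exists e, (src e == u) && (rng e == w)]].
Definition reach : rel (vertex E) := connect adj.

Lemma adj_edge e : adj (src e) (rng e).
Proof. by apply/existsP; exists e; rewrite !eqxx. Qed.

Lemma adjP u w : adj u w -> exists e, src e = u /\ rng e = w.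
Proof. by case/existsP => e /andP[/eqP <- /eqP <-]; exists e. Qed.

Lemma reach_refl u : reach u u. Proof. exact: connect0. Qed.

Lemma reach_edge e : reach (src e) (rng e).
Proof. exact/connect1/adj_edge. Qed.

Lemma reach_trans : transitive reach. Proof. exact: connect_trans. Qed.

Lemma reach_ind (P : vertex E -> Prop) w :
  P w -> (forall e, reach (rng e) w -> P (rng e) -> P (src e)) ->
  forall u, reach u w -> P u.
Proof.
move=> Pw Pstep u /connectP[p pP wE]; elim: p u pP wE => [|y p IHp] u /=.
  by move=> _ <-.
move=> /andP[/adjP[e [<- <-]] pP] wE; apply: Pstep; last exact: IHp.
by apply/connectP; exists p.
Qed.

Lemma reach_step u w : reach u w -> u = w \/ exists2 e, src e = u & reach (rng e) w.
Proof.
pose P u := u = w \/ exists2 e, src e = u & reach (rng e) w.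
apply: (reach_ind (P := P)).
  by left.
by move=> e ew _; right; exists e.
Qed.

(** Lets a return path be shortened to distinct vertices first and read as a cycle of edges
    afterwards. *)
Lemma edge_path e s : path adj (rng e) s -> exists q,
  [/\ path (@composable E) e q, [seq rng f | f <- q] = s
    & [seq src f | f <- q] = belast (rng e) s].
Proof.
elim: s e => [|y s IHs] e /=; first by exists [::].
move=> /andP[/adjP[f [fe fy]]]; rewrite -fy => /IHs[q [qP qr qs]].
by exists (f :: q); rewrite /= {1}/composable /= fe eqxx qr qs.
Qed.

(** Membership in a terminal strongly connected component. In a no-exit graph this means being a
    sink or lying on a cycle, and both cases are treated together from here on. *)
Definition recurrent u : bool := [forall w, reach u w ==> reach w u].

Lemma recurrentP u w : recurrent u -> reach u w -> reach w u.
Proof. by move=> /forallP/(_ w)/implyP. Qed.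

Lemma recurrent_reach u w : recurrent u -> reach u w -> recurrent w.
Proof.
move=> ru uw; apply/forallP => x; apply/implyP => wx.
have xu := recurrentP ru (reach_trans uw wx); exact: reach_trans xu uw.
Qed.

Lemma reach_sink u w : ~~ regular u -> reach u w -> w = u.
Proof.
move=> ureg /reach_step[->//|[e se _]]; case/negP: ureg.
by apply/existsP; exists e; rewrite se.
Qed.

Lemma sink_recurrent u : ~~ regular u -> recurrent u.
Proof.
move=> us; apply/forallP => w; apply/implyP => uw.
by rewrite (reach_sink us uw) reach_refl.
Qed.

Lemma recurrent_regular u w : recurrent u -> regular u -> reach u w -> regular w.
Proof.
move=> ru rg uw; apply: contraT => ws.
by move: rg; rewrite (reach_sink ws (recurrentP ru uw)) (negPf ws).
Qed.

(* [pick] depends only on the extension of its predicate, so [rep] is constant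
   on the strongly connected component of a recurrent vertex. *)
Definition rep u : vertex E := odflt u [pick w | reach u w].

Lemma reach_rep u : reach u (rep u).
Proof. by rewrite /rep; case: pickP => //=; rewrite reach_refl. Qed.

Lemma rep_reach u w : recurrent u -> reach u w -> rep u = rep w.
Proof.
move=> ru uw; have wu := recurrentP ru uw.
rewrite /rep (@eq_pick _ (reach u) (reach w)).
  by case: pickP => //= /(_ w); rewrite reach_refl.
by move=> x; apply/idP/idP; apply: reach_trans.
Qed.

Lemma rep_id u : recurrent u -> rep (rep u) = rep u.
Proof. by move=> ru; rewrite -(rep_reach ru (reach_rep u)). Qed.

Hypothesis noex : no_exit E.

(** A return path with distinct vertices closes e up to a cycle, for which any other edge out of src
    e would be an exit. *)
Lemma unique_out e f : reach (rng e) (src e) -> src f = src e -> f = e.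
Proof.
case/connectP => s sP; case/shortenP: sP => t tP t_uniq _ te sf.
have [q [qP qr qs]] := edge_path tP.
have lq : composable (last e q) e.
  by rewrite /composable /= -(last_map (@rng E)) qr -te.
apply/eqP; apply: contraT => fe.
case: (@noex (e :: q)); last first.
  by exists f; apply/existsP; exists e; rewrite mem_head sf eqxx fe.
rewrite /Defs.cycle_path /closed_path /= rcons_path qP lq qs /=.
by move: t_uniq; rewrite lastI rcons_uniq -te.
Qed.

(** No path from src e can leave the cycle: at each vertex x that it visits, [unique_out] forces the
    next edge to be the first edge of a return path. The induction carries reachability between x
    and src e in both directions. *)
Lemma return_recurrent e : reach (rng e) (src e) -> recurrent (src e).
Proof.
move=> es; apply/forallP => w; apply/implyP => /connectP[p pP ->].
have: reach (src e) (src e) by exact: reach_refl.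
have: reach (src e) (src e) by exact: reach_refl.
move: {1 2 5 6}(src e) pP => x; elim: p x => [|y p IHp] x //=.
move=> /andP[/adjP[g [gx gy]] pP] xe ex.
have ey : reach (src e) y.
  by apply: reach_trans ex _; rewrite -gx -gy; exact: reach_edge.
apply: IHp pP _ ey; rewrite -gy; have [xE|[h hx he]] := reach_step xe.
  by have -> : g = e by apply: unique_out es _; rewrite gx.
suff <- : h = g by [].
by apply/esym/unique_out; rewrite hx //; exact: reach_trans he ex.
Qed.

Lemma recurrent_out e f : recurrent (src e) -> src f = src e -> f = e.
Proof. by move=> re; apply: unique_out; exact/(recurrentP re)/reach_edge. Qed.

(** The choice is forced at a recurrent vertex of a no-exit graph. Sinks are fixed, to match the
    loops that [tau] has there. *)
Definition succ_vertex u : vertex E :=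
  if [pick e | src e == u] is Some e then rng e else u.

Lemma succ_src e : recurrent (src e) -> succ_vertex (src e) = rng e.
Proof.
move=> re; rewrite /succ_vertex.
case: pickP => [f /eqP /(recurrent_out re) -> //|/(_ e)].
by rewrite eqxx.
Qed.

Lemma succ_sink u : ~~ regular u -> succ_vertex u = u.
Proof.
move=> us; rewrite /succ_vertex; case: pickP => // e se; case/negP: us.
by apply/existsP; exists e.
Qed.

Lemma reach_succ k u : reach u (iter k succ_vertex u).
Proof.
elim: k => [|k IHk] /=; first exact: reach_refl.
apply: reach_trans IHk _; rewrite {2}/succ_vertex; case: pickP => [e /eqP <-|_].
  exact: reach_edge.
exact: reach_refl.
Qed.

Lemma recurrent_iter u w :
  recurrent u -> reach u w -> exists k, w = iter k succ_vertex u.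
Proof.
move=> ru uw; move: u uw ru.
apply: (reach_ind (P := fun u => recurrent u -> exists k, _)) => [_|e _ IH re].
  by exists 0.
have [|k ->] := IH; first exact: (recurrent_reach re (reach_edge e)).
by exists k.+1; rewrite iterSr succ_src.
Qed.

(** The bound m is there because [corner_tau] holds for large powers only, and a large power
    returning to u is wanted. *)
Lemma recurrent_period u m :
  recurrent u -> exists2 k, (m <= k)%N & iter k succ_vertex u = u.
Proof.
move=> ru; have [o oE] : exists o, iter o.+1 succ_vertex u = u.
  have [k kE] := recurrent_iter (recurrent_reach ru (reach_succ 1 u))
    (recurrentP ru (reach_succ 1 u)).
  by exists k; rewrite iterSr -kE.
exists (m * o.+1)%N; first exact: leq_pmulr.
by elim: m => // m IHm; rewrite mulSn iterD IHm.
Qed.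
End Graph.

(** * Corners of a no-exit Leavitt path algebra *)

Section Structure.
Variables (K : fieldType) (E : finGraph).
Local Notation L := (leavitt K E).
Local Notation vt := (vt K).
Local Notation ed := (ed K).
Local Notation gh := (gh K).
Implicit Types (u v w : vertex E) (e f : edge E) (p q : seq (edge E)).

Lemma monomial_vt v p q w :
  vt v * edp K p * ghp K q * vt w = vt v * edp K p * ghp K q \/
  vt v * edp K p * ghp K q * vt w = 0.
Proof.
case: q => [|f q]; last first.
  rewrite ghp_cons -!mulrA gh_vt; case: eqP => _; first by left.
  by right; rewrite !mulr0.
rewrite ghp_nil mulr1; case/lastP: p => [|p f].
  rewrite edp_nil mulr1 vt_vt; case: eqP => [->|_]; by [left | right].
rewrite edp_rcons -!mulrA ed_vt; case: eqP => _; first by left.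
by right; rewrite !mulr0.
Qed.

(* v L is the K-span of the monomials v p q^*, stated as an induction principle. *)
Lemma monomial_span v (P : L -> Prop) :
  P 0 -> (forall x y, P x -> P y -> P (x + y)) ->
  (forall a x, P x -> P (a *: x)) ->
  (forall p q, P (vt v * edp K p * ghp K q)) -> forall x, P (vt v * x).
Proof.
move=> P0 PD PZ Pm x.
(* P is quantified inside the induction, because the product case applies the hypothesis on x to the
   predicate z => P (z * y). *)
suff : forall x (P : L -> Prop), P 0 -> (forall x y, P x -> P y -> P (x + y)) ->
    (forall a x, P x -> P (a *: x)) ->
    (forall p q, P (vt v * edp K p * ghp K q)) ->
    forall p q, P (vt v * edp K p * ghp K q * x).
  move=> /(_ x P P0 PD PZ Pm [::] [::]).
  by rewrite edp_nil ghp_nil !mulr1.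
move=> {P P0 PD PZ Pm} {}x; elim/leavitt_ind: x.
- move=> w P P0 PD PZ Pm p q.
  by case: (monomial_vt v p q w) => ->.
- move=> e P P0 PD PZ Pm p [|f q].
    rewrite ghp_nil mulr1 -mulrA -edp_rcons.
    by have := Pm (rcons p e) [::]; rewrite ghp_nil mulr1.
  rewrite ghp_cons -!mulrA gh_ed; case: eqP => _; rewrite ?mulr0 // !mulrA.
  by case: (monomial_vt v p q (rng f)) => ->.
- by move=> e P P0 PD PZ Pm p q; rewrite -mulrA -ghp_cons.
- by move=> P P0 PD PZ Pm p q; rewrite mulr0.
- move=> x y IHx IHy P P0 PD PZ Pm p q; rewrite mulrDr.
  by apply: (PD); [exact: IHx P P0 PD PZ Pm _ _ | exact: IHy P P0 PD PZ Pm _ _].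
- move=> a x IHx P P0 PD PZ Pm p q; rewrite -scalerAr; apply: (PZ).
  exact: IHx P P0 PD PZ Pm _ _.
- move=> x y IHx IHy P P0 PD PZ Pm p q; rewrite mulrA.
  apply: (IHx (fun z => P (z * y))) => [|z t Pz Pt|a z Pz|p' q'].
  + by rewrite mul0r.
  + by rewrite mulrDl; exact: PD.
  + by rewrite -scalerAl; exact: PZ.
  + exact: IHy P P0 PD PZ Pm _ _.
Qed.

Definition ideal_of (z x : L) : Prop :=
  exists n (a b : 'I_n -> L), x = \sum_i a i * z * b i.

Lemma ideal_of0 z : ideal_of z 0.
Proof. by exists 0%N, (fun=> 0), (fun=> 0); rewrite big_ord0. Qed.

Lemma ideal_ofD z x y : ideal_of z x -> ideal_of z y -> ideal_of z (x + y).
Proof.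
case=> m [a [b ->]] [n [c [d ->]]]; exists (m + n)%N.
exists (fun i => match split i with inl j => a j | inr j => c j end).
exists (fun i => match split i with inl j => b j | inr j => d j end).
rewrite big_split_ord /=; congr (_ + _); apply: eq_bigr => i _.
  by rewrite (unsplitK (inl i)).
by rewrite (unsplitK (inr i)).
Qed.

Lemma ideal_ofM z x y t : ideal_of z x -> ideal_of z (y * x * t).
Proof.
case=> m [a [b ->]]; exists m, (fun i => y * a i), (fun i => b i * t).
by rewrite mulr_sumr mulr_suml; apply: eq_bigr => i _; rewrite !mulrA.
Qed.

Lemma ideal_of_regular z v : regular v ->
  (forall e, src e = v -> ideal_of z (vt (rng e))) -> ideal_of z (vt v).
Proof.
move=> vreg Jv; rewrite (vt_regular K vreg).
apply: (big_ind (ideal_of z)); [exact: ideal_of0 | exact: ideal_ofD|].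
move=> e /eqP /Jv/(ideal_ofM (ed e) (gh e)).
by rewrite ed_vt eqxx.
Qed.

Hypothesis noex : no_exit E.
Local Notation next := (@succ_vertex E).

(* On a recurrent vertex, tau moves along the only outgoing edge; the loops
   added at the sinks make this step invertible everywhere. *)
Definition tau : L :=
  \sum_(e | recurrent (src e)) ed e + \sum_(w | ~~ regular w) vt w.

Lemma vt_tau_src e : recurrent (src e) -> vt (src e) * tau = ed e.
Proof.
move=> re; rewrite mulrDr !mulr_sumr (bigD1 e) //= vt_ed eqxx.
rewrite big1 ?addr0 => [|f /andP[_ fe]]; last first.
  rewrite vt_ed; case: eqP => // /esym /(recurrent_out noex re) fe'.
  by rewrite fe' eqxx in fe.
rewrite big1 ?addr0 // => w wreg; rewrite vt_vt; case: eqP => // we.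
by case/negP: wreg; apply/existsP; exists e; rewrite we.
Qed.

Lemma vt_tau_sink w : ~~ regular w -> vt w * tau = vt w.
Proof.
move=> ws; rewrite mulrDr !mulr_sumr big1 ?add0r => [|e _]; last first.
  rewrite vt_ed; case: eqP => // we; case/negP: ws.
  by apply/existsP; exists e; rewrite we.
rewrite (bigD1 w) //= vt_idem big1 ?addr0 // => u /andP[_ uw].
by rewrite vt_vt eq_sym (negPf uw).
Qed.

Lemma vt_tau_next w : recurrent w -> vt w * tau * vt (next w) = vt w * tau.
Proof.
move=> rw; have [/existsP[e /eqP we]|ws] := boolP (regular w).
  by rewrite -we in rw *; rewrite vt_tau_src // (succ_src noex rw) ed_vt eqxx.
by rewrite vt_tau_sink // succ_sink // vt_idem.
Qed.

Lemma recurrent_iter_next k w : recurrent w -> recurrent (iter k next w).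
Proof. by move=> rw; apply: recurrent_reach rw (reach_succ k w). Qed.

Lemma vt_tauX_next k w : recurrent w ->
  vt w * tau ^+ k * vt (iter k next w) = vt w * tau ^+ k.
Proof.
move=> rw; elim: k => [|k IHk]; first by rewrite mulr1 vt_idem.
rewrite exprSr mulrA -IHk /= -!mulrA; congr (_ * (_ * _)); rewrite !mulrA.
exact/vt_tau_next/recurrent_iter_next.
Qed.

Lemma vt_tauX_vt k w u : recurrent w ->
  vt w * tau ^+ k * vt u = if iter k next w == u then vt w * tau ^+ k else 0.
Proof.
move=> rw; rewrite -vt_tauX_next // -mulrA vt_vt.
by case: eqP => [<-|_]; rewrite ?mulr0.
Qed.

(** From a recurrent vertex there is no choice of edges, so a nonzero path must follow [tau]. *)
Lemma vt_edp v p : recurrent v ->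
  vt v * edp K p = 0 \/ vt v * edp K p = vt v * tau ^+ size p.
Proof.
elim: p v => [|e p IHp] v rv; first by right; rewrite edp_nil.
rewrite edp_cons mulrA vt_ed; case: eqP => [ve|_]; last by left; rewrite mul0r.
rewrite ve in rv *; have edE : ed e = ed e * vt (rng e) by rewrite ed_vt eqxx.
rewrite exprS mulrA vt_tau_src // edE -!mulrA.
have [|->|->] := IHp (rng e); first exact: recurrent_reach rv (reach_edge e).
- by left; rewrite mulr0.
- by right.
Qed.

(** Each ghost edge cancels one step of [tau] by the relation between e^* and e. *)
Lemma ghp_vt_tau q w k : recurrent w -> (size q <= k)%N ->
  ghp K q * vt w * tau ^+ k = 0 \/ exists2 u, recurrent u &
  ghp K q * vt w * tau ^+ k = vt u * tau ^+ (k - size q).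
Proof.
elim: q w k => [|e q IHq] w k rw.
  by right; exists w; rewrite // ghp_nil mul1r subn0.
case: k => // k /= qk; rewrite ghp_cons -(mulrA _ (gh e)) gh_vt.
case: eqP => [ew|_]; last by left; rewrite mulr0 mul0r.
have <- : gh e * vt w = gh e by rewrite gh_vt ew eqxx.
rewrite exprS -!mulrA (mulrA (vt w)) -ew vt_tau_src ?ew // (mulrA (gh e)) gh_ed eqxx.
rewrite subSS mulrA; apply: IHq => //; apply: recurrent_reach (reach_edge e).
by rewrite ew.
Qed.

Definition ht (g : {poly K}) : L := horner_alg tau g.

Lemma ht0 : ht 0 = 0. Proof. exact: raddf0. Qed.
Lemma htD g h : ht (g + h) = ht g + ht h. Proof. exact: raddfD. Qed.
Lemma htB g h : ht (g - h) = ht g - ht h. Proof. exact: raddfB. Qed.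
Lemma htM g h : ht (g * h) = ht g * ht h. Proof. exact: rmorphM. Qed.
Lemma htZ a g : ht (a *: g) = a *: ht g.
Proof. by rewrite -mul_polyC htM /ht horner_algC -scalerAl mul1r. Qed.
Lemma htXn k : ht 'X^k = tau ^+ k.
Proof. by rewrite /ht rmorphXn /= horner_algX. Qed.

Lemma htE g : ht g = \sum_(i < size g) g`_i *: tau ^+ i.
Proof.
rewrite -{1}[g]coefK poly_def (big_morph ht htD ht0); apply: eq_bigr => i _.
by rewrite htZ htXn.
Qed.

(** Once k exceeds the lengths of all ghost paths in x, none of them survives. Allowing every k >= m
    gives sums a common exponent and leaves k free to be a return time. *)
Lemma corner_tau v w x : recurrent v -> recurrent w ->
  exists m, forall k, (m <= k)%N ->
  exists g : {poly K}, vt v * x * vt w * tau ^+ k = vt v * ht g.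
Proof.
move=> rv rw; apply: (monomial_span (P := fun z => exists m, forall k, (m <= k)%N ->
  exists g : {poly K}, z * vt w * tau ^+ k = vt v * ht g)).
- by exists 0%N => k _; exists 0; rewrite !mul0r ht0 mulr0.
- move=> y z [m mP] [n nP]; exists (maxn m n) => k; rewrite geq_max => /andP[mk nk].
  have [[g gE] [h hE]] := (mP _ mk, nP _ nk).
  by exists (g + h); rewrite !mulrDl gE hE htD mulrDr.
- move=> a y [m mP]; exists m => k /mP[g gE]; exists (a *: g).
  by rewrite -!scalerAl gE htZ -scalerAr.
move=> p q; exists (size q) => k /(ghp_vt_tau rw) [q0|[u ru qE]].
  by exists 0; rewrite -!mulrA (mulrA (ghp K q)) q0 !mulr0 ht0 mulr0.
rewrite -!mulrA (mulrA (ghp K q)) qE mulrA.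
have [->|->] := vt_edp p rv; first by exists 0; rewrite mul0r ht0 mulr0.
rewrite mulrA vt_tauX_vt //; case: eqP => _; last by exists 0; rewrite mul0r ht0 mulr0.
by exists 'X^(size p + (k - size q)); rewrite htXn exprD mulrA.
Qed.

(** At a recurrent regular vertex the relation v = sum of e e^* has a single term, so e^* undoes a
    step of [tau]. *)
Lemma vt_tauX_inv k w : recurrent w -> exists y, vt w * tau ^+ k * y = vt w.
Proof.
elim: k w => [|k IHk] w rw; first by exists 1; rewrite !mulr1.
have [y yE] := IHk (next w) (recurrent_iter_next 1 rw).
have [/existsP[e /eqP we]|ws] := boolP (regular w).
  exists (y * gh e); rewrite -we in rw y yE *.
  have edE : ed e = ed e * vt (rng e) by rewrite ed_vt eqxx.
  rewrite (succ_src noex rw) in yE.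
  rewrite exprS (mulrA _ tau) vt_tau_src // edE mulrA.
  rewrite -(mulrA (ed e)) -(mulrA (ed e)) yE.
  rewrite ed_vt eqxx.
  rewrite vt_regular; last by apply/existsP; exists e.
  rewrite (big_pred1 e) // => f /=; apply/eqP/eqP => [/(recurrent_out noex rw)|->] //.
by exists y; rewrite succ_sink // in yE; rewrite exprS mulrA vt_tau_sink.
Qed.

Lemma vt_tauX_cancel x k w : recurrent w -> x * vt w * tau ^+ k = 0 -> x * vt w = 0.
Proof.
move=> /(vt_tauX_inv k)[y yE] x0.
by rewrite -yE !mulrA x0 mul0r.
Qed.

Lemma vt_tauX_sink k w : ~~ regular w -> vt w * tau ^+ k = vt w.
Proof.
move=> ws; elim: k => [|k IHk]; first by rewrite mulr1.
by rewrite exprS mulrA vt_tau_sink.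
Qed.

Lemma vt_tauX_period x k w : recurrent w -> iter k next w = w ->
  x * vt w * tau ^+ k * vt w = x * vt w * tau ^+ k.
Proof.
move=> rw kw; have := vt_tauX_next k rw; rewrite kw => wk.
by rewrite -[x * vt w * _]mulrA -mulrA wk.
Qed.

(** For a large return time k of w, v x w [tau]^k is a polynomial in [tau] starting at v and is
    fixed by w on the right. Every term vanishes, since no walk from v ends at w. *)
Lemma vt_orth v w x : recurrent v -> recurrent w -> ~~ reach v w ->
  vt v * x * vt w = 0.
Proof.
move=> rv rw nvw; have [m mP] := corner_tau x rv rw.
have [k mk kw] := recurrent_period noex m rw.
have [g gE] := mP k mk.
apply: (vt_tauX_cancel rw (k := k)).
rewrite -(vt_tauX_period _ rw kw) gE htE mulr_sumr mulr_suml big1 // => i _.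
rewrite -scalerAr -scalerAl vt_tauX_vt //; case: eqP => [vi|_]; last by rewrite scaler0.
by rewrite -vi reach_succ in nvw.
Qed.

(** The part of g that survives in v g([tau]) v: the exponents i for which i steps from v lead back
    to v. *)
Definition return_part v (g : {poly K}) : {poly K} :=
  \poly_(i < size g) (if iter i next v == v then g`_i else 0).

Lemma ht_return v g : recurrent v ->
  vt v * ht g * vt v = vt v * ht (return_part v g).
Proof.
move=> rv; rewrite /return_part poly_def (big_morph ht htD ht0).
rewrite htE !mulr_sumr mulr_suml; apply: eq_bigr => i _.
rewrite -scalerAr -scalerAl vt_tauX_vt // htZ htXn -scalerAr.
by case: eqP => _; rewrite ?scaler0 ?scale0r.
Qed.

Lemma corner_period v x : recurrent v -> exists k g,
  [/\ iter k next v = v, vt v * x * vt v * tau ^+ k = vt v * ht g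
    & vt v * ht g = vt v * ht g * vt v].
Proof.
move=> rv; have [m mP] := corner_tau x rv rv.
have [k mk kv] := recurrent_period noex m rv.
have [g gE] := mP k mk; exists k, g; split=> //.
by rewrite -gE vt_tauX_period.
Qed.

(** Euclidean division in K[X]: each x in J is moved to the form v g([tau]) by a return power of
    [tau], divided by an element of this form with minimal size, and moved back. *)
Lemma vt_corner_principal v : recurrent v -> corner_principal (vt v).
Proof.
move=> rv J J0 JB Jv JM.
(* Nonvanishing is required of v g([tau]) and not of g: at a sink [tau] acts as 1, so a nonzero g
   may give 0. *)
pose S n := `[< exists2 g : {poly K},
  size g = n & J (vt v * ht g) /\ vt v * ht g <> 0 >].
have Jpow x k : J x -> iter k next v = v -> J (x * tau ^+ k).
  move=> Jx kv; have xv : x * vt v = x by rewrite -(Jv x Jx) -!mulrA vt_idem.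
  have := JM x (tau ^+ k) Jx; rewrite vt_tauX_vt // kv eqxx mulrA xv.
  done.
have Jcancel x k : J x -> x * tau ^+ k = 0 -> x = 0.
  move=> Jx; have xv : x * vt v = x by rewrite -(Jv x Jx) -!mulrA vt_idem.
  by rewrite -{1}xv => /(vt_tauX_cancel rv); rewrite xv.
have Jg x : J x -> exists k g,
    [/\ iter k next v = v, x * tau ^+ k = vt v * ht g & J (vt v * ht g)].
  move=> Jx; have [k [g [kv gE _]]] := corner_period x rv; exists k, g.
  by rewrite Jv // in gE; split=> //; rewrite -gE; exact: Jpow.
have [exS|noS] := pselect (exists n, S n); last first.
  exists 0 => // x Jx; exists 0; rewrite mul0r.
  have [k [g [kv gE Jgg]]] := Jg x Jx.
  apply: (@Jcancel _ k) => //; apply: contrapT => x0; apply: noS; exists (size g).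
  by apply/asboolP; exists g => //; rewrite -gE; split=> //; rewrite gE.
case: (ex_minnP exS) => n /asboolP[d dn [Jd d0]] nmin.
exists (vt v * ht d) => // x Jx; have [k [g [kv gE Jgg]]] := Jg x Jx.
have dv : vt v * ht d * vt v = vt v * ht d.
  by have := Jv _ Jd; rewrite !mulrA vt_idem.
have gv : vt v * ht g * vt v = vt v * ht g.
  by have := Jv _ Jgg; rewrite !mulrA vt_idem.
have dE s : vt v * ht d * (vt v * ht s * vt v) = vt v * ht (s * d) * vt v.
  by rewrite !mulrA dv -(mulrA _ (ht d)) -htM [d * s]mulrC.
(* The remainder may contain powers that do not return to v; its return part stays in the corner and
   is no longer. *)
have rE : vt v * ht (return_part v (g %% d))
    = vt v * ht g - vt v * ht d * (vt v * ht (g %/ d) * vt v).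
  rewrite -ht_return // -{1}(addKr (g %/ d * d) (g %% d)) -divp_eq.
  by rewrite addrC htB mulrBr mulrBl gv dE.
have r0 : vt v * ht (return_part v (g %% d)) = 0.
  apply: contrapT => r0.
  have /nmin : S (size (return_part v (g %% d))).
    apply/asboolP; exists (return_part v (g %% d)) => //; split=> //.
    by rewrite rE; apply: JB => //; exact: JM.
  apply/negP; rewrite -ltnNge -dn; apply: leq_ltn_trans (size_poly _ _) _.
  by apply: ltn_modpN0; apply: contra_not_neq d0 => ->; rewrite ht0 mulr0.
have xE : x * tau ^+ k = vt v * ht d * (vt v * ht (g %/ d) * vt v).
  by rewrite gE; apply/eqP; rewrite -subr_eq0 -rE r0.
(* y undoes the power of [tau] by which x was multiplied. *)
have [y yE] := vt_tauX_inv k rv.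
exists (ht (g %/ d) * vt v * y).
have xv : x * vt v = x by rewrite -(Jv x Jx) -!mulrA vt_idem.
transitivity (x * tau ^+ k * y * vt v).
  by rewrite -{2}xv -(mulrA x) -(mulrA x) yE -mulrA vt_idem xv.
by rewrite xE !mulrA.
Qed.

(** By v = sum of e e^*, membership in the ideal passes backwards along edges. A recurrent v walks
    to [rep v]. From any other v, each edge leads to a vertex that reaches strictly fewer vertices,
    since a return would make v recurrent. *)
Lemma ideal_of_recurrent z :
  (forall w, recurrent w -> rep w = w -> ideal_of z (vt w)) ->
  forall v, ideal_of z (vt v).
Proof.
move=> Jrep; have Jrec v : recurrent v -> ideal_of z (vt v).
  move=> rv; have [k kE] := recurrent_iter noex rv (reach_rep v).
  have : ideal_of z (vt (iter k next v)).
    by rewrite -kE; apply: Jrep; [exact: recurrent_reach (reach_rep v) | exact: rep_id].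
  elim: k v rv {kE} => // k IHk v rv; rewrite iterSr.
  move=> /(IHk _ (recurrent_iter_next 1 rv)) /= Jnext.
  have [vreg|vs] := boolP (regular v); last by rewrite succ_sink in Jnext.
  apply: ideal_of_regular => // e ev; rewrite -ev in rv Jnext.
  by rewrite (succ_src noex) in Jnext.
move=> v; have [n] := ubnP #|reach v|; elim: n v => // n IHn v vn.
have [/Jrec //|nrv] := boolP (recurrent v).
have vreg : regular v by apply: contraNT nrv; exact: sink_recurrent.
rewrite ltnS in vn; apply: ideal_of_regular => // e ev.
apply: IHn; apply: leq_trans _ vn.
apply: proper_card; apply/properP; split.
  by apply/subsetP => w; rewrite !inE -ev; apply: reach_trans; exact: reach_edge.
exists v; rewrite inE; first exact: reach_refl.
by rewrite -ev; apply: contraNN nrv => /(return_recurrent noex); rewrite ev.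
Qed.
End Structure.

(** * Embedding the corners into a field by eigenvalues of a twisted representation *)

Section Twist.
Variables (K F : fieldType) (E : finGraph) (frac : {rmorphism {poly K} -> F}).
Hypothesis frac_eq0 : forall g, (frac g == 0) = (g == 0).
Local Notation L := (leavitt K E).
Implicit Types (v w : vertex E) (e f : edge E) (x y : L).

Definition fracX : F := frac 'X.
Definition fracC (a : K) : F := frac a%:P.

Lemma fracX_neq0 : fracX != 0.
Proof. by rewrite frac_eq0 polyX_eq0. Qed.

(* The grading automorphism e |-> X e, e^* |-> X^-1 e^*, after extension of
   scalars along [frac] (K[X] -> K(X) in the application). *)
Fixpoint twist_expr (x : lexpr K E) : leavitt F E :=
  match x with
  | Vert v => vt F v
  | Edge e => fracX *: ed F e
  | Ghost e => fracX^-1 *: gh F e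
  | Zero => 0
  | Add y z => twist_expr y + twist_expr z
  | Scale a y => fracC a *: twist_expr y
  | Mul y z => twist_expr y * twist_expr z
  end.

Lemma twist_expr_rel (x y : lexpr K E) : leq_rel x y -> twist_expr x = twist_expr y.
Proof.
have XK : fracX * fracX^-1 = 1 by rewrite divff // fracX_neq0.
have XVK : fracX^-1 * fracX = 1 by rewrite mulVf // fracX_neq0.
elim=> {x y} //=.
- by move=> x y z _ -> _ ->.
- by move=> x x' y y' _ -> _ ->.
- by move=> a x x' _ ->.
- by move=> x x' y y' _ -> _ ->.
- by move=> x y z; rewrite addrA.
- by move=> x y; rewrite addrC.
- by move=> x; rewrite add0r.
- by move=> x; rewrite /fracC polyCN rmorphN /= rmorph1 scaleN1r addNr.
- by move=> a b x; rewrite scalerA /fracC polyCM rmorphM.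
- by move=> x; rewrite /fracC rmorph1 scale1r.
- by move=> a x y; rewrite scalerDr.
- by move=> a b x; rewrite /fracC polyCD rmorphD /= scalerDl.
- by move=> x y z; rewrite mulrA.
- by move=> x y z; rewrite mulrDl.
- by move=> x y z; rewrite mulrDr.
- by move=> a x y; rewrite scalerAl.
- by move=> a x y; rewrite scalerAr.
- by move=> v w; rewrite vt_vt; case: eqP.
- by move=> e; rewrite -scalerAr vt_ed eqxx.
- by move=> e; rewrite -scalerAl ed_vt eqxx.
- by move=> e; rewrite -scalerAr vt_gh eqxx.
- by move=> e; rewrite -scalerAl gh_vt eqxx.
- move=> e f; rewrite -scalerAl -scalerAr scalerA XVK scale1r gh_ed.
  by case: eqP.
- move=> v /(vt_regular F) ->.
  rewrite (big_morph twist_expr (id1 := 0) (op1 := +%R)) //.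
  by apply: eq_bigr => e _ /=; rewrite -scalerAl -scalerAr scalerA XK scale1r.
Qed.

Definition twist x : leavitt F E := twist_expr (repr x).

Lemma twist_pi (x : lexpr K E) : twist (\pi_(leavitt K E) x) = twist_expr x.
Proof. exact/twist_expr_rel/leavitt_repr_pi. Qed.

Lemma twistD x y : twist (x + y) = twist x + twist y.
Proof. by elim/quotW: x => x; elim/quotW: y => y; rewrite -leavitt_piD !twist_pi. Qed.

Lemma twistM x y : twist (x * y) = twist x * twist y.
Proof. by elim/quotW: x => x; elim/quotW: y => y; rewrite -leavitt_piM !twist_pi. Qed.

Lemma twistZ a x : twist (a *: x) = fracC a *: twist x.
Proof. by elim/quotW: x => x; rewrite -leavitt_piZ !twist_pi. Qed.

Definition states := nat -> vertex E -> F.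
Implicit Types phi : states.

(** The representation used for the nonvanishing of 1, now over F. It is defined on expressions,
    hence the representative; by [leq_rel_act] its choice is immaterial. *)
Definition twist_act x phi : states := lact (repr (twist x)) phi.

Fact states_ext phi phi' : (forall n u, phi n u = phi' n u) -> phi = phi'.
Proof.
by move=> eq_phi; apply: functional_extensionality_dep => n;
  apply: functional_extensionality_dep => u.
Qed.

Fact lact_repr_pi (z : lexpr F E) phi n u :
  lact (repr (\pi_(leavitt F E) z)) phi n u = lact z phi n u.
Proof. exact/leq_rel_act/leavitt_repr_pi. Qed.

Fact leavitt_pi_surj (z : leavitt F E) : exists t, z = \pi_(leavitt F E) t.
Proof. by exists (repr z); rewrite reprK. Qed.

Lemma twist_actD x y phi n u :
  twist_act (x + y) phi n u = twist_act x phi n u + twist_act y phi n u.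
Proof.
rewrite /twist_act twistD; have [s ->] := leavitt_pi_surj (twist x).
have [t ->] := leavitt_pi_surj (twist y).
by rewrite -leavitt_piD !lact_repr_pi.
Qed.

Lemma twist_actZ a x phi n u :
  twist_act (a *: x) phi n u = fracC a * twist_act x phi n u.
Proof.
rewrite /twist_act twistZ; have [s ->] := leavitt_pi_surj (twist x).
by rewrite -leavitt_piZ !lact_repr_pi.
Qed.

Lemma twist_actM x y phi : twist_act (x * y) phi = twist_act x (twist_act y phi).
Proof.
apply: states_ext => n u.
rewrite /twist_act twistM; have [s ->] := leavitt_pi_surj (twist x).
have [t ->] := leavitt_pi_surj (twist y).
rewrite -leavitt_piM !lact_repr_pi /=; apply: lact_ext => m w.
by rewrite lact_repr_pi.
Qed.

Lemma twist_act_scale x c phi :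
  twist_act x (fun n u => c * phi n u) = fun n u => c * twist_act x phi n u.
Proof. by apply: states_ext => n u; exact: lactZ. Qed.

Lemma twist_act0 phi n u : twist_act 0 phi n u = 0.
Proof.
by apply: (addrI (twist_act 0 phi n u)); rewrite -twist_actD !addr0.
Qed.

Lemma twist_act_vt v phi n u :
  twist_act (vt K v) phi n u = if u == v then phi n u else 0.
Proof. by rewrite /twist_act twist_pi lact_repr_pi. Qed.

Hypothesis noex : no_exit E.
Local Notation next := (@succ_vertex E).

(** The scalar contributed by one step of [tau]: the twist multiplies an edge by X and fixes the
    vertices that [tau] uses at sinks. *)
Definition weight v : F := if regular v then fracX else 1.

Lemma weight_neq0 v : weight v != 0.
Proof.
by rewrite /weight; case: ifP => _; [exact: fracX_neq0 | exact: oner_neq0].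
Qed.

Lemma twist_act_tau v phi n u : recurrent v ->
  twist_act (vt K v * tau K E) phi n u
  = if u == v then weight v * phi n (next v) else 0.
Proof.
move=> rv; rewrite /weight; have [/existsP[e /eqP ev]|vs] := boolP (regular v).
  rewrite -ev in rv *; rewrite vt_tau_src // (succ_src noex) // /twist_act twist_pi.
  rewrite /= -leavitt_piZ lact_repr_pi /=.
  (* With a single outgoing edge, the euclidean division in [lact] is by 1 and leaves n
     unchanged. *)
  have outs1 : Defs.outs (src e) = [:: e].
    rewrite /Defs.outs -(enum1 e); apply: eq_enum => f; rewrite !inE.
    by apply/eqP/eqP => [/(recurrent_out noex rv)|->].
  case: eqP => [->|_]; last by rewrite mulr0.
  by rewrite /Defs.deg outs1 modn1 divn1 /Defs.rk outs1 /= eqxx.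
by rewrite vt_tau_sink // succ_sink // twist_act_vt mul1r; case: eqP => [->|].
Qed.

Lemma weight_next k v : recurrent v -> weight (iter k next v) = weight v.
Proof.
move=> rv; rewrite /weight; have rk := reach_succ k v.
have -> // : regular (iter k next v) = regular v.
apply/idP/idP => [kreg|vreg]; last exact: recurrent_regular vreg rk.
apply: recurrent_regular kreg _; first exact: recurrent_reach rv rk.
exact: recurrentP rk.
Qed.

Lemma twist_act_tauX k v phi n u : recurrent v ->
  twist_act (vt K v * tau K E ^+ k) phi n u
  = if u == v then weight v ^+ k * phi n (iter k next v) else 0.
Proof.
move=> rv; elim: k phi n u => [|k IHk] phi n u.
  by rewrite mulr1 mul1r twist_act_vt; case: eqP => [->|].
have rk := recurrent_iter_next k rv.
rewrite exprSr mulrA -(vt_tauX_next K noex k rv) -(mulrA _ (vt K _)) twist_actM IHk.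
case: ifP => // _; rewrite twist_act_tau // eqxx mulrA weight_next //.
by rewrite exprSr.
Qed.

Definition indic v : states := fun _ u => (u == v)%:R.
(** The eigenvalue of x at [indic v], read off at one point; [corner_eval_indic] shows that corner
    elements do have [indic v] as an eigenvector. *)
Definition corner_eval v x : F := twist_act x (indic v) 0%N v.
Local Notation ret k v := (iter k next v == v).

Lemma twist_act_ht v g n u : recurrent v ->
  twist_act (vt K v * ht E g) (indic v) n u
  = (\sum_(i < size g | ret i v) fracC g`_i * weight v ^+ i) * indic v n u.
Proof.
move=> rv; rewrite htE mulr_sumr.
rewrite (big_morph (fun x => twist_act x (indic v) n u)
  (fun x y => twist_actD x y (indic v) n u) (twist_act0 (indic v) n u)).
rewrite mulr_suml [RHS]big_mkcond; apply: eq_bigr => i _.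
rewrite -scalerAr twist_actZ twist_act_tauX // /indic.
by case: (u == v); case: ifP => _; rewrite ?mulr0 ?mulr1.
Qed.

Lemma twist_act_period v y k : recurrent v -> iter k next v = v ->
  twist_act (y * (vt K v * tau K E ^+ k)) (indic v)
    = fun n u => weight v ^+ k * twist_act y (indic v) n u.
Proof.
move=> rv kv; rewrite twist_actM -twist_act_scale; congr twist_act.
apply: states_ext => n u; rewrite twist_act_tauX // kv /indic.
by rewrite eqxx; case: (u == v); rewrite ?mulr0.
Qed.

Lemma twist_act_corner v x k g n u : recurrent v -> iter k next v = v ->
  vt K v * x * vt K v * tau K E ^+ k = vt K v * ht E g ->
  weight v ^+ k * twist_act (vt K v * x * vt K v) (indic v) n u
    = (\sum_(i < size g | ret i v) fracC g`_i * weight v ^+ i) * indic v n u.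
Proof.
move=> rv kv xg; rewrite -twist_act_ht // -xg.
have xE : vt K v * x * vt K v * (vt K v * tau K E ^+ k)
    = vt K v * x * vt K v * tau K E ^+ k.
  by rewrite mulrA -(mulrA _ (vt K v) (vt K v)) vt_idem.
by rewrite -xE twist_act_period.
Qed.

(** After multiplication by a return power of [tau], x becomes a polynomial in [tau] whose returning
    terms scale [indic v]. The power itself acts on [indic v] by a nonzero scalar, which is
    cancelled. *)
Lemma corner_eval_indic v x : recurrent v ->
  twist_act (vt K v * x * vt K v) (indic v)
    = fun n u => corner_eval v (vt K v * x * vt K v) * indic v n u.
Proof.
move=> rv; have [k [g [kv xg _]]] := corner_period noex x rv.
apply: states_ext => n u; apply: (mulfI (expf_neq0 k (weight_neq0 v))).
rewrite mulrA /corner_eval !(twist_act_corner _ _ rv kv xg).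
by rewrite /indic eqxx mulr1.
Qed.

Lemma corner_evalM v x y : recurrent v ->
  corner_eval v (vt K v * x * vt K v * (vt K v * y * vt K v))
    = corner_eval v (vt K v * x * vt K v) * corner_eval v (vt K v * y * vt K v).
Proof.
move=> rv; rewrite {1}/corner_eval twist_actM (corner_eval_indic y) //.
by rewrite twist_act_scale mulrC.
Qed.

Lemma corner_eval_vt v : corner_eval v (vt K v) = 1.
Proof. by rewrite /corner_eval twist_act_vt /indic !eqxx. Qed.

Lemma corner_evalB v x y : corner_eval v (x - y) = corner_eval v x - corner_eval v y.
Proof. by apply/eqP; rewrite -subr_eq opprK /corner_eval -twist_actD subrK. Qed.

(** On a cycle the weight is X, so the eigenvalue is the image of the return part of g and
    determines it; with weight 1 only the sum of its coefficients would be seen. At a sink that sum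
    suffices, because v g([tau]) is the sum times v. *)
Lemma corner_eval_inj v x : recurrent v ->
  corner_eval v (vt K v * x * vt K v) = 0 -> vt K v * x * vt K v = 0.
Proof.
move=> rv x0; have [k [g [kv xg gv]]] := corner_period noex x rv.
apply: (vt_tauX_cancel noex rv (k := k)); rewrite xg.
have := twist_act_corner 0 v rv kv xg.
rewrite -/(corner_eval v _) x0 mulr0 /indic eqxx mulr1 => /esym sum0.
have [vreg|vs] := boolP (regular v).
  rewrite gv ht_return // (_ : return_part v g = 0) ?ht0 ?mulr0 //.
  apply/eqP; rewrite -frac_eq0 -[X in _ == X]sum0 /return_part poly_def rmorph_sum /=.
  rewrite [X in _ == X]big_mkcond; apply/eqP/eq_bigr => i _.
  rewrite /weight vreg -mul_polyC rmorphM rmorphXn /=.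
  by case: eqP => _; rewrite // polyC0 rmorph0 mul0r.
rewrite htE mulr_sumr.
under eq_bigr => i _ do rewrite -scalerAr vt_tauX_sink //.
rewrite -scaler_suml (_ : \sum_i _ = 0) ?scale0r //.
apply/eqP; rewrite -(polyC_eq0) -frac_eq0 -[X in _ == X]sum0 !rmorph_sum /=.
rewrite [X in _ == X]big_mkcond; apply/eqP/eq_bigr => i _.
rewrite /weight (negPf vs) expr1n mulr1.
have -> : iter i next v = v by elim: (nat_of_ord i) => //= j ->; exact: succ_sink.
by rewrite eqxx.
Qed.
End Twist.

(** * Cancellation over no-exit graphs, and the equivalence *)

Lemma no_exit_cancellation (K : fieldType) (E : finGraph) :
  no_exit E -> cancellation_of_projectives (leavitt K E).
Proof.
move=> noex; pose I := {v : vertex E | recurrent v && (rep v == v)}.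
have recI (i : I) : recurrent (val i) by case/andP: (valP i).
have repI (i : I) : rep (val i) = val i by case/andP: (valP i) => _ /eqP.
pose F := {fraction {poly K}}.
pose ev (i : I) := corner_eval (@tofrac {poly K}) (val i).
have frac_eq0 (g : {poly K}) : (tofrac g == 0) = (g == 0) by exact: tofrac_eq0.
have evB (i : I) : zmod_morphism (ev i : leavitt K E -> F).
  by move=> x y; exact: corner_evalB.

pose th (i : I) : {additive leavitt K E -> F} :=
  HB.pack (ev i) (GRing.isZmodMorphism.Build _ _ _ (evB i)).
have [n [a [b full]]] : ideal_of (\sum_(i : I) vt K (val i)) (1 : leavitt K E).
  rewrite -sum_vt; apply: (big_ind (ideal_of _)) => [|x y|v _].
  - exact: ideal_of0.
  - exact: ideal_ofD.
  apply: ideal_of_recurrent => // w rw rew.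
  have wP : recurrent w && (rep w == w) by rewrite rw rew eqxx.
  (* A chosen vertex w lies in the ideal because w times the sum of all chosen vertices is w. *)
  exists 1%N, (fun=> vt K w), (fun=> 1); rewrite big_ord1 mulr1 mulr_sumr.
  rewrite (bigD1 (Sub w wP : I)) //= vt_idem big1 ?addr0 // => i iw.
  rewrite vt_vt; case: eqP => // wi; case/eqP: iw.
  by apply: val_inj; rewrite SubK wi.
apply: (orthogonal_corners_cancellation (v := fun i : I => vt K (val i))
  (a := a) (b := b) (th := th)).
- by move=> i; exact: vt_idem.
- move=> i j x ij; apply: vt_orth => //; apply: contraNN ij => ij.
  by apply/eqP/val_inj; rewrite -(repI i) -(repI j); exact: rep_reach.
- by rewrite full.
- by move=> i; exact: vt_corner_principal.
- by move=> i; exact: corner_eval_vt.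
- by move=> i x y; exact: corner_evalM.
- by move=> i x; exact: corner_eval_inj.
Qed.

Theorem theorem4p2 (E : finGraph) (K : fieldType) :
  [<-> cancellation_of_projectives (leavitt K E);
       hermite (leavitt K E);
       stably_finite (leavitt K E);
       directly_finite (leavitt K E);
       no_exit E].
Proof.
tfae.
- exact: cancellation_hermite.
- exact: hermite_stably_finite.
- exact: stably_finite_directly_finite.
- exact: directly_finite_no_exit.
- exact: no_exit_cancellation.
Qed.
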